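(* (i) For every real $x \ge e^{400}$, the interval $(x, x+5x^{1/5}\log x]$ contains a squarefree integer. (ii) For every real $x \ge e^{1800}$, the interval $(x, x+2x^{1/5}\log x]$ contains a squarefree integer. (iii) For every real $x \ge e^{500000}$, the interval $(x, x+x^{1/5}\log x]$ contains a squarefree integer.
   Context: An integer $n$ is squarefree if it is not divisible by $p^2$ for any prime $p$. Here $\log$ is the natural logarithm. *)

(* Defs.v *)
From Stdlib Require Import ZArith Znumtheory.

Definition squarefree (n : Z) : Prop :=
  forall p : Z, prime p -> ~ (p ^ 2 | n)%Z.

(* Main.v *)
Require Import Defs.
From Stdlib Require Import ZArith Znumtheory Reals.
From Stdlib Require Import Lra Lia Psatz List ClassicalEpsilon FinFun.
Import ListNotations.
Open Scope R_scope.

(** Put [x = y^5] and [h = T y] with [T = c ln x], and suppose that no integer in [(x, x + h]] is squarefree. Multiples of [4] and of [d^2] for odd [d < h/8] account for at most [h/4 + h/4 + h/16 + 1] integers, so at least about [7h/16] odd [u >= h/8] have a multiple [m_u u^2] in [(x, x + h]]; such [u] are called hits.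

Hits are counted in windows [[U, V)] by the method of Filaseta and Trifonov. For consecutive hits [u] and [u + 2a] the integer [D = (a - u) m_u + (u + 3a) m_{u+2a}] differs from [4 x a^3 / (u^2 (u + 2a)^2)] by less than [h / u]. For a fixed [a] this leaves few values of [D], and two [u] with the same [D] are close together. On the other hand, if [u] and [u + 2b] both start a gap [2a], then a mixed second difference and a parallelogram third difference of the four multipliers are positive integers, so [b] cannot be small. Hence each value of [D] is taken few times, and a window contains few short gaps; long gaps are few for trivial reasons. With gaps cut at about [u / y], each window with bounded ratio [V / U] contains [O(y)] hits, except near [U = h/8], where a smaller cut-off is used. For [U >= y^2 / T] already [D >= 1] forces all gaps to be long. *)

(** * Counting integers by fibres *)

(** The factor [ln x] is a number of windows. Between [y T^3] and [y^2 / T] there are at most about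
    (41/30) ln x of them, and each costs a fixed multiple of [y], since gaps longer than about
    [u / y] are counted by their length alone. Together these windows cost about 0.2936 y ln x in
    the leading term, while an interval without squarefree integers needs about (7/16) c y ln x
    hits; hence even c = 1 is within reach. The other contributions are of lower order but carry
    large factors, which is why smaller c needs larger x: a multiple of T^(2/7) from the windows
    near [h/8], a multiple of T^(1/3) from those beyond [y^2 / T], and a constant. The window ratio
    (41/40)^6 is a compromise: a smaller ratio lowers the cost per unit of ln u, but raises the
    geometric sum (here 41) in the constant. The inequality 10000 T^9 <= y turns terms polynomial in
    [T] into slack. Window positions are written as exact sixth or seventh powers, and [r], [r2]
    majorize the two roots of [T], so that no fractional power occurs. *)

Definition atmost (P : Z -> Prop) (r : R) : Prop :=
  forall l : list Z, NoDup l -> (forall z, In z l -> P z) -> INR (length l) <= r.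

Fixpoint rsum (f : nat -> R) (n : nat) : R :=
  match n with O => 0 | S k => rsum f k + f k end.

Lemma rsum_le (f g : nat -> R) (n : nat) :
  (forall k, (k < n)%nat -> f k <= g k) -> rsum f n <= rsum g n.
Proof.
  induction n as [|n IH]; intros H; simpl; [lra|].
  assert (f n <= g n) by (apply H; lia).
  assert (rsum f n <= rsum g n) by (apply IH; intros; apply H; lia). lra.
Qed.

Lemma rsum_plus (f g : nat -> R) (n : nat) :
  rsum (fun k => f k + g k) n = rsum f n + rsum g n.
Proof. induction n as [|n IH]; simpl; lra. Qed.

Lemma rsum_scal (c : R) (f : nat -> R) (n : nat) :
  rsum (fun k => c * f k) n = c * rsum f n.
Proof. induction n as [|n IH]; simpl; lra. Qed.

Lemma rsum_const (c : R) (n : nat) : rsum (fun _ => c) n = INR n * c.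
Proof. induction n as [|n IH]; [simpl; lra|]. rewrite S_INR. simpl. rewrite IH. lra. Qed.

Lemma atmost_le (P Q : Z -> Prop) (r s : R) :
  (forall z, P z -> Q z) -> r <= s -> atmost Q r -> atmost P s.
Proof.
  intros HPQ Hrs HQ l Hl Hin. apply Rle_trans with r; auto.
Qed.

(** Because cardinality is tested on arbitrary lists, no finiteness proof is needed: a classical
    filter splits each list in two. *)
Lemma atmost_or (P Q : Z -> Prop) (r s : R) :
  atmost P r -> atmost Q s -> atmost (fun z => P z \/ Q z) (r + s).
Proof.
  intros HP HQ l Hl Hin.
  set (f := fun z => if excluded_middle_informative (P z) then true else false).
  assert (Hlen := filter_length f l).
  assert (H1 : INR (length (filter f l)) <= r).
  { apply HP; [now apply NoDup_filter|]. intros z Hz. apply filter_In in Hz.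
    destruct Hz as [_ Hz]. unfold f in Hz.
    destruct (excluded_middle_informative (P z)); [assumption|discriminate]. }
  assert (H2 : INR (length (filter (fun z => negb (f z)) l)) <= s).
  { apply HQ; [now apply NoDup_filter|]. intros z Hz. apply filter_In in Hz.
    destruct Hz as [Hz Hf]. unfold f in Hf. destruct (Hin z Hz) as [H|H]; [|assumption].
    destruct (excluded_middle_informative (P z)); [discriminate|contradiction]. }
  rewrite <- Hlen, plus_INR. lra.
Qed.

Lemma atmost_false (P : Z -> Prop) : (forall z, ~ P z) -> atmost P 0.
Proof.
  intros H l _ Hin. destruct l as [|z l]; [simpl; lra|].
  exfalso. apply (H z), Hin. now left.
Qed.

Lemma atmost_cover (P : Z -> Prop) (Q : nat -> Z -> Prop) (r : nat -> R) (n : nat) :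
  (forall z, P z -> exists k, (k < n)%nat /\ Q k z) ->
  (forall k, (k < n)%nat -> atmost (Q k) (r k)) ->
  atmost P (rsum r n).
Proof.
  revert P. induction n as [|n IH]; intros P HP HQ; simpl.
  - apply atmost_false. intros z Hz. destruct (HP z Hz) as [k [Hk _]]. lia.
  - apply atmost_le with (fun z => (exists k, (k < n)%nat /\ Q k z) \/ Q n z) (rsum r n + r n).
    + intros z Hz. destruct (HP z Hz) as [k [Hk HQk]].
      destruct (Nat.eq_dec k n) as [->|Hne]; [now right|].
      left. exists k. split; [lia|assumption].
    + lra.
    + apply atmost_or; [|apply HQ; lia].
      apply IH; [auto|]. intros k Hk. apply HQ. lia.
Qed.

Lemma atmost_transfer (P Q : Z -> Prop) (rel : Z -> Z -> Prop) (r : R) :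
  (forall z, P z -> exists w, Q w /\ rel z w) ->
  (forall z z' w, P z -> P z' -> rel z w -> rel z' w -> z = z') ->
  atmost Q r -> atmost P r.
Proof.
  intros Hex Hinj HQ l Hl Hin.
  set (f := fun z => epsilon (inhabits 0%Z) (fun w => Q w /\ rel z w)).
  assert (Hf : forall z, P z -> Q (f z) /\ rel z (f z)).
  { intros z Hz. unfold f. apply epsilon_spec. now apply Hex. }
  rewrite <- (length_map f). apply HQ.
  - apply NoDup_map_NoDup_ForallPairs; [|assumption].
    intros a b Ha Hb Hab. apply Hinj with (f a); [now apply Hin|now apply Hin|apply Hf; auto|].
    rewrite Hab. apply Hf; auto.
  - intros w Hw. apply in_map_iff in Hw. destruct Hw as [z [<- Hz]]. apply Hf; auto.
Qed.

Lemma atmost_one (P : Z -> Prop) :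
  (forall z z', P z -> P z' -> ~ (z < z')%Z) -> atmost P 1.
Proof.
  intros H l Hl Hin. destruct l as [|a [|b l]]; simpl; try lra. exfalso.
  inversion Hl as [|? ? Ha _]; subst.
  assert (a <> b) by (intros ->; apply Ha; now left).
  assert (Pa : P a) by (apply Hin; now left).
  assert (Pb : P b) by (apply Hin; right; now left).
  destruct (Z.lt_total a b) as [?|[?|?]]; [now apply (H a b)|auto|now apply (H b a)].
Qed.

Lemma atmost_two (P : Z -> Prop) :
  (forall z z' z'', P z -> P z' -> P z'' -> ~ (z < z' < z'')%Z) -> atmost P 2.
Proof.
  intros H l Hl Hin. destruct l as [|a [|b [|c l]]]; simpl; try lra. exfalso.
  inversion Hl as [|? ? Ha Hl']; subst. inversion Hl' as [|? ? Hb _]; subst.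
  assert (a <> b) by (intros ->; apply Ha; now left).
  assert (a <> c) by (intros ->; apply Ha; right; now left).
  assert (b <> c) by (intros ->; apply Hb; now left).
  assert (Pa : P a) by (apply Hin; now left).
  assert (Pb : P b) by (apply Hin; right; now left).
  assert (Pc : P c) by (apply Hin; right; right; now left).
  assert ((a < b < c \/ a < c < b \/ b < a < c \/ b < c < a \/ c < a < b \/ c < b < a)%Z)
    as [Ho|[Ho|[Ho|[Ho|[Ho|Ho]]]]] by lia.
  - exact (H a b c Pa Pb Pc Ho).
  - exact (H a c b Pa Pc Pb Ho).
  - exact (H b a c Pb Pa Pc Ho).
  - exact (H b c a Pb Pc Pa Ho).
  - exact (H c a b Pc Pa Pb Ho).
  - exact (H c b a Pc Pb Pa Ho).
Qed.

Lemma atmost_fibres (P : Z -> Prop) (f : Z -> Z) (p q r : R) :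
  p <= q -> 0 <= r ->
  (forall z, P z -> p <= IZR (f z) <= q) ->
  (forall d, atmost (fun z => P z /\ f z = d) r) ->
  atmost P ((q - p + 1) * r).
Proof.
  intros Hpq Hr Hf Hfib.
  (* [up z] is the floor of [z] plus one. So [lo] is the ceiling of [p], and the integers of
     [[p, q]] are [lo], ..., [up q - 1]. *)
  set (lo := (- (up (- p) - 1))%Z). set (n := Z.to_nat (up q - lo)).
  destruct (archimed (- p)) as [Hp1 Hp2]. destruct (archimed q) as [Hq1 Hq2].
  assert (Hlo : IZR lo = 1 - IZR (up (- p))) by (unfold lo; rewrite opp_IZR, minus_IZR; lra).
  assert (Hlo1 : p <= IZR lo) by lra.
  assert (Hn : INR n <= q - p + 1).
  { unfold n. destruct (Z_le_gt_dec 0 (up q - lo)) as [H|H].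
    - rewrite INR_IZR_INZ, Z2Nat.id by assumption. rewrite minus_IZR. lra.
    - replace (Z.to_nat (up q - lo)) with O by lia. simpl. lra. }
  apply atmost_le with P (rsum (fun _ => r) n); [auto| |].
  - rewrite rsum_const. now apply Rmult_le_compat_r.
  - apply atmost_cover with (fun k z => P z /\ f z = (lo + Z.of_nat k)%Z); [|auto].
    intros z Hz. destruct (Hf z Hz) as [H1 H2].
    assert (f z < up q)%Z by (apply lt_IZR; lra).
    assert (lo - 1 < f z)%Z by (apply lt_IZR; rewrite minus_IZR; lra).
    exists (Z.to_nat (f z - lo)). split; [unfold n; lia|]. split; [assumption|]. lia.
Qed.

Lemma Int_part_div_bounds (z p s : R) : 0 < s ->
  IZR (Int_part ((z - p) / s)) * s <= z - p < (IZR (Int_part ((z - p) / s)) + 1) * s.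
Proof.
  intros Hs. destruct (base_Int_part ((z - p) / s)) as [H1 H2].
  assert (E : z - p = (z - p) / s * s) by (field; lra).
  set (d := (z - p) / s) in *. rewrite E. split; nra.
Qed.

Lemma Int_part_div_range (z p q s : R) : 0 < s -> p <= z <= q ->
  0 <= IZR (Int_part ((z - p) / s)) <= (q - p) / s.
Proof.
  intros Hs Hz. destruct (Int_part_div_bounds z p s Hs) as [H1 H2].
  set (k := Int_part ((z - p) / s)) in *. split.
  - apply IZR_le. assert (-1 < k)%Z; [|lia]. apply lt_IZR.
    apply Rnot_le_lt. intros Hk. nra.
  - apply Rmult_le_reg_r with s; [assumption|].
    replace ((q - p) / s * s) with (q - p) by (field; lra). lra.
Qed.

(** Half-open blocks of length [s], laid from [p] on, hold one element each. *)
Lemma atmost_spaced (P : Z -> Prop) (p q s : R) : 0 < s -> p <= q ->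
  (forall z, P z -> p <= IZR z <= q) ->
  (forall z z', P z -> P z' -> (z < z')%Z -> s <= IZR z' - IZR z) ->
  atmost P ((q - p) / s + 1).
Proof.
  intros Hs Hpq Hin Hsp.
  replace ((q - p) / s + 1) with (((q - p) / s - 0 + 1) * 1) by ring.
  apply atmost_fibres with (fun z => Int_part ((IZR z - p) / s)).
  - apply Rmult_le_pos; [lra|]. now apply Rlt_le, Rinv_0_lt_compat.
  - lra.
  - intros z Hz. apply Int_part_div_range; auto.
  - intros d. apply atmost_one. intros z z' [Hz Ez] [Hz' Ez'] Hlt.
    assert (H := Hsp z z' Hz Hz' Hlt).
    destruct (Int_part_div_bounds (IZR z) p s Hs) as [H1 _].
    destruct (Int_part_div_bounds (IZR z') p s Hs) as [_ H2].
    rewrite Ez in H1. rewrite Ez' in H2. lra.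
Qed.

(** Needed because the third difference vanishes when the shift equals the half-gap: adjacent
    starting points may escape it, and only those two apart are known to be far from each other. *)
Lemma atmost_spaced3 (P : Z -> Prop) (p q s : R) : 0 < s -> p <= q ->
  (forall z, P z -> p <= IZR z <= q) ->
  (forall z z' z'', P z -> P z' -> P z'' -> (z < z' < z'')%Z -> s <= IZR z'' - IZR z) ->
  atmost P (((q - p) / s + 1) * 2).
Proof.
  intros Hs Hpq Hin Hsp.
  replace ((q - p) / s + 1) with ((q - p) / s - 0 + 1) by ring.
  apply atmost_fibres with (fun z => Int_part ((IZR z - p) / s)).
  - apply Rmult_le_pos; [lra|]. now apply Rlt_le, Rinv_0_lt_compat.
  - lra.
  - intros z Hz. apply Int_part_div_range; auto.
  - intros d. apply atmost_two. intros z z' z'' [Hz Ez] [Hz' Ez'] [Hz'' Ez''] Hlt.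
    assert (H := Hsp z z' z'' Hz Hz' Hz'' Hlt).
    destruct (Int_part_div_bounds (IZR z) p s Hs) as [H1 _].
    destruct (Int_part_div_bounds (IZR z'') p s Hs) as [_ H2].
    rewrite Ez in H1. rewrite Ez'' in H2. lra.
Qed.

Lemma list_min (l : list Z) : l <> [] ->
  exists m, In m l /\ forall z, In z l -> (m <= z)%Z.
Proof.
  induction l as [|a l IH]; [congruence|]. intros _.
  destruct l as [|b l].
  - exists a. split; [now left|]. intros z [->|[]]. lia.
  - destruct IH as [m [Hm Hle]]; [discriminate|].
    destruct (Z_le_gt_dec a m) as [H|H].
    + exists a. split; [now left|]. intros z [->|Hz]; [lia|]. specialize (Hle z Hz). lia.
    + exists m. split; [now right|]. intros z [->|Hz]; [lia|]. now apply Hle.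
Qed.

Lemma atmost_diameter (P : Z -> Prop) (len r : R) : 0 <= r ->
  (forall z z', P z -> P z' -> IZR z' - IZR z <= len) ->
  (forall p, atmost (fun z => P z /\ p <= IZR z <= p + len) r) ->
  atmost P r.
Proof.
  intros Hr Hd Hp l Hl Hin. destruct l as [|a l']; [simpl; lra|].
  destruct (list_min (a :: l')) as [m [Hm Hle]]; [discriminate|].
  apply (Hp (IZR m)); [assumption|]. intros z Hz.
  assert (IZR m <= IZR z) by (apply IZR_le; auto).
  assert (IZR z - IZR m <= len) by (apply Hd; auto).
  split; [auto|lra].
Qed.

(** * Integer combinations of the multipliers *)

Lemma near_inverse_square (x h t m U : R) : 0 < h -> 0 < U <= t ->
  x < m * t ^ 2 <= x + h ->
  exists e, m = x / t ^ 2 + e /\ 0 < e <= h / U ^ 2.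
Proof.
  intros Hh [HU Ht] Hm. exists ((m * t ^ 2 - x) / t ^ 2).
  assert (H2 : 0 < U ^ 2) by nra. assert (H3 : U ^ 2 <= t ^ 2) by nra.
  split; [field; lra|]. split.
  - apply Rdiv_lt_0_compat; lra.
  - apply Rle_trans with (h / t ^ 2); unfold Rdiv.
    + apply Rmult_le_compat_r; [left; apply Rinv_0_lt_compat; lra|lra].
    + apply Rmult_le_compat_l; [lra|]. now apply Rinv_le_contravar.
Qed.

(** The differences of [x / t^2] used below are positive combinations of monomials in the
    reciprocals of the nodes, so bounding each monomial at the ends of the window replaces a mean
    value theorem. *)
Lemma prod_inv_bounds (U V : R) (l : list R) : 0 < U ->
  (forall z, In z l -> U <= z <= V) ->
  / V ^ length l <= fold_right (fun z acc => / z * acc) 1 l <= / U ^ length l.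
Proof.
  intros HU. induction l as [|z l IH]; intros Hl; simpl.
  - rewrite Rinv_1. lra.
  - destruct IH as [IH1 IH2]; [intros; apply Hl; now right|].
    destruct (Hl z) as [H1 H2]; [now left|].
    rewrite !Rinv_mult.
    assert (/ V <= / z) by (apply Rinv_le_contravar; lra).
    assert (/ z <= / U) by (apply Rinv_le_contravar; lra).
    assert (0 < / V) by (apply Rinv_0_lt_compat; lra).
    assert (0 < / V ^ length l) by (apply Rinv_0_lt_compat, pow_lt; lra).
    split; apply Rmult_le_compat; lra.
Qed.

(* The Pade-type identity [v^2 (v - 3 u) + u^2 (3 v - u) = (v - u)^3], with [v = u + 2 a], halved. *)
Lemma cubic_combination (x h t a m1 m2 : R) : 0 < h -> 0 < a < t ->
  x < m1 * t ^ 2 <= x + h -> x < m2 * (t + 2 * a) ^ 2 <= x + h ->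
  Rabs ((a - t) * m1 + (t + 3 * a) * m2 - 4 * x * a ^ 3 / (t ^ 2 * (t + 2 * a) ^ 2)) < h / t.
Proof.
  intros Hh Ha H1 H2.
  set (d1 := m1 * t ^ 2 - x). set (d2 := m2 * (t + 2 * a) ^ 2 - x).
  replace ((a - t) * m1 + (t + 3 * a) * m2 - 4 * x * a ^ 3 / (t ^ 2 * (t + 2 * a) ^ 2))
    with ((t + 3 * a) * d2 / (t + 2 * a) ^ 2 - (t - a) * d1 / t ^ 2)
    by (unfold d1, d2; field; lra).
  assert (B1 : 0 < (t - a) * d1 / t ^ 2 < h / t).
  { split; [apply Rdiv_lt_0_compat; unfold d1; nra|].
    apply Rmult_lt_reg_r with (t ^ 2); [nra|].
    replace ((t - a) * d1 / t ^ 2 * t ^ 2) with ((t - a) * d1) by (field; lra).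
    replace (h / t * t ^ 2) with (h * t) by (field; lra). unfold d1. nra. }
  assert (B2 : 0 < (t + 3 * a) * d2 / (t + 2 * a) ^ 2 < h / t).
  { split; [apply Rdiv_lt_0_compat; unfold d2; nra|].
    apply Rmult_lt_reg_r with (t * (t + 2 * a) ^ 2); [apply Rmult_lt_0_compat; nra|].
    replace ((t + 3 * a) * d2 / (t + 2 * a) ^ 2 * (t * (t + 2 * a) ^ 2))
      with ((t + 3 * a) * t * d2) by (field; lra).
    replace (h / t * (t * (t + 2 * a) ^ 2)) with ((t + 2 * a) ^ 2 * h) by (field; lra).
    assert (0 < d2 <= h) by (unfold d2; lra).
    apply Rle_lt_trans with ((t + 3 * a) * t * h); [apply Rmult_le_compat_l; nra|].
    apply Rmult_lt_compat_r; nra. }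
  apply Rabs_def1; lra.
Qed.

(** The main term is that of 4 a b f'' for f(t) = x / t^2. The rounding errors lie in [(0, h / U^2]]
    and enter with two plus and two minus signs, hence the [2 * h / U^2]. *)
Lemma mixed_second_difference (x h t a b U V m1 m2 m3 m4 : R) :
  0 < x -> 0 < h -> 0 < a -> 0 < b -> 0 < U <= t -> t + 2 * a + 2 * b <= V ->
  x < m1 * t ^ 2 <= x + h -> x < m2 * (t + 2 * a) ^ 2 <= x + h ->
  x < m3 * (t + 2 * b) ^ 2 <= x + h -> x < m4 * (t + 2 * a + 2 * b) ^ 2 <= x + h ->
  24 * x * (a * b) / V ^ 4 - 2 * h / U ^ 2 < m1 - m2 - m3 + m4
    < 24 * x * (a * b) / U ^ 4 + 2 * h / U ^ 2.
Proof.
  intros Hx Hh Ha Hb HU HV H1 H2 H3 H4.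
  destruct (near_inverse_square x h t m1 U) as [e1 [-> B1]]; try lra.
  destruct (near_inverse_square x h (t + 2 * a) m2 U) as [e2 [-> B2]]; try lra.
  destruct (near_inverse_square x h (t + 2 * b) m3 U) as [e3 [-> B3]]; try lra.
  destruct (near_inverse_square x h (t + 2 * a + 2 * b) m4 U) as [e4 [-> B4]]; try lra.
  set (s := t + 2 * a + 2 * b) in *.
  set (q := t + 2 * a) in *. set (r := t + 2 * b) in *.
  assert (K : forall l, length l = 4%nat -> incl l [t; q; r; s] ->
     / V ^ 4 <= fold_right (fun z acc => / z * acc) 1 l <= / U ^ 4).
  { intros l <- Hl. apply prod_inv_bounds; [lra|]. intros z Hz.
    destruct (Hl z Hz) as [<-|[<-|[<-|[<-|[]]]]]; unfold s, q, r in *; lra. }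
  assert (K1 := K [t; t; q; r] eq_refl ltac:(intros z Hz; simpl in Hz |- *; intuition)).
  assert (K2 := K [t; q; r; r] eq_refl ltac:(intros z Hz; simpl in Hz |- *; intuition)).
  assert (K3 := K [q; r; r; s] eq_refl ltac:(intros z Hz; simpl in Hz |- *; intuition)).
  assert (K4 := K [t; q; q; r] eq_refl ltac:(intros z Hz; simpl in Hz |- *; intuition)).
  assert (K5 := K [q; q; r; s] eq_refl ltac:(intros z Hz; simpl in Hz |- *; intuition)).
  assert (K6 := K [q; r; s; s] eq_refl ltac:(intros z Hz; simpl in Hz |- *; intuition)).
  simpl fold_right in *.
  match type of K1 with _ <= ?a <= _ => set (f1 := a) in * end.
  match type of K2 with _ <= ?a <= _ => set (f2 := a) in * end.
  match type of K3 with _ <= ?a <= _ => set (f3 := a) in * end.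
  match type of K4 with _ <= ?a <= _ => set (f4 := a) in * end.
  match type of K5 with _ <= ?a <= _ => set (f5 := a) in * end.
  match type of K6 with _ <= ?a <= _ => set (f6 := a) in * end.
  assert (E : x / t ^ 2 - x / q ^ 2 - x / r ^ 2 + x / s ^ 2
    = 4 * x * (a * b) * (f1 + f2 + f3 + f4 + f5 + f6)).
  { unfold f1, f2, f3, f4, f5, f6, s, q, r in *. field. repeat split; lra. }
  assert (0 < x * (a * b)) by (apply Rmult_lt_0_compat; [lra|]; apply Rmult_lt_0_compat; lra).
  assert (4 * x * (a * b) * (6 * / V ^ 4) <= 4 * x * (a * b) * (f1 + f2 + f3 + f4 + f5 + f6)
     <= 4 * x * (a * b) * (6 * / U ^ 4)) by (split; apply Rmult_le_compat_l; lra).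
  unfold Rdiv in *. split; lra.
Qed.

(* A third divided difference at the vertices of a parallelogram: cancelling the common factor of the Lagrange denominators leaves coefficients linear in [a] and [b]. *)
Lemma parallelogram_third_difference (x h t a b U V m1 m2 m3 m4 : R) :
  0 < x -> 0 < h -> 0 < a -> a < b -> 0 < U <= t -> t + 2 * a + 2 * b <= V ->
  x < m1 * t ^ 2 <= x + h -> x < m2 * (t + 2 * a) ^ 2 <= x + h ->
  x < m3 * (t + 2 * b) ^ 2 <= x + h -> x < m4 * (t + 2 * a + 2 * b) ^ 2 <= x + h ->
  32 * x * (a * b * (b ^ 2 - a ^ 2)) / V ^ 5 - 2 * b * h / U ^ 2
    < (b + a) * (m3 - m2) - (b - a) * (m4 - m1)
    < 32 * x * (a * b * (b ^ 2 - a ^ 2)) / U ^ 5 + 2 * b * h / U ^ 2.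
Proof.
  intros Hx Hh Ha Hb HU HV H1 H2 H3 H4.
  destruct (near_inverse_square x h t m1 U) as [e1 [-> B1]]; try lra.
  destruct (near_inverse_square x h (t + 2 * a) m2 U) as [e2 [-> B2]]; try lra.
  destruct (near_inverse_square x h (t + 2 * b) m3 U) as [e3 [-> B3]]; try lra.
  destruct (near_inverse_square x h (t + 2 * a + 2 * b) m4 U) as [e4 [-> B4]]; try lra.
  set (s := t + 2 * a + 2 * b) in *.
  set (q := t + 2 * a) in *. set (r := t + 2 * b) in *.
  assert (K : forall l, length l = 5%nat -> incl l [t; q; r; s] ->
     / V ^ 5 <= fold_right (fun z acc => / z * acc) 1 l <= / U ^ 5).
  { intros l <- Hl. apply prod_inv_bounds; [lra|]. intros z Hz.
    destruct (Hl z Hz) as [<-|[<-|[<-|[<-|[]]]]]; unfold s, q, r in *; lra. }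
  assert (K1 := K [t; t; q; r; s] eq_refl ltac:(intros z Hz; simpl in Hz |- *; intuition)).
  assert (K2 := K [t; q; q; r; s] eq_refl ltac:(intros z Hz; simpl in Hz |- *; intuition)).
  assert (K3 := K [t; q; r; r; s] eq_refl ltac:(intros z Hz; simpl in Hz |- *; intuition)).
  assert (K4 := K [t; q; r; s; s] eq_refl ltac:(intros z Hz; simpl in Hz |- *; intuition)).
  simpl fold_right in *.
  match type of K1 with _ <= ?a <= _ => set (f1 := a) in * end.
  match type of K2 with _ <= ?a <= _ => set (f2 := a) in * end.
  match type of K3 with _ <= ?a <= _ => set (f3 := a) in * end.
  match type of K4 with _ <= ?a <= _ => set (f4 := a) in * end.
  (* The third divided difference of 1/z^2 is, up to sign, the sum of the reciprocals of the nodes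
     over their product; this is [f1 + f2 + f3 + f4]. *)
  assert (E : (b + a) * (x / r ^ 2 - x / q ^ 2) - (b - a) * (x / s ^ 2 - x / t ^ 2)
    = 8 * x * (a * b * (b ^ 2 - a ^ 2)) * (f1 + f2 + f3 + f4)).
  { unfold f1, f2, f3, f4, s, q, r in *. field. repeat split; lra. }
  assert (0 < x * (a * b * (b ^ 2 - a ^ 2))).
  { apply Rmult_lt_0_compat; [lra|]. apply Rmult_lt_0_compat; nra. }
  assert (8 * x * (a * b * (b ^ 2 - a ^ 2)) * (4 * / V ^ 5)
     <= 8 * x * (a * b * (b ^ 2 - a ^ 2)) * (f1 + f2 + f3 + f4)
     <= 8 * x * (a * b * (b ^ 2 - a ^ 2)) * (4 * / U ^ 5)) by (split; apply Rmult_le_compat_l; lra).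
  assert (- ((b + a) * (h / U ^ 2)) < (b + a) * (e3 - e2) < (b + a) * (h / U ^ 2)) by (split; nra).
  assert (- ((b - a) * (h / U ^ 2)) < (b - a) * (e4 - e1) < (b - a) * (h / U ^ 2)) by (split; nra).
  unfold Rdiv in *. split; lra.
Qed.

(** * Starting points of a given gap *)

Definition hit (x h : R) (u : Z) : Prop :=
  Z.odd u = true /\ exists m : Z, x < IZR m * IZR u ^ 2 <= x + h.

Definition window_hit (x h U V : R) (u : Z) : Prop :=
  hit x h u /\ U <= IZR u < V.

Definition gap_start (x h U V : R) (a u : Z) : Prop :=
  window_hit x h U V u /\ window_hit x h U V (u + 2 * a) /\
  forall v, window_hit x h U V v -> (u < v)%Z -> (u + 2 * a <= v)%Z.

(* [s] will bound the half-distance between non-adjacent starting points of a gap [2a], [a <= A]. The inequalities make, in this order, the rounding errors small, the second difference positive, the third difference positive, and the third difference less than [1] when [b < s]. *)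
Definition admissible (x h U V A s : R) : Prop :=
  (0 < x /\ 0 < h /\ 0 < U < V /\ V <= 2 * U /\ 0 < s) /\
  4 * h <= U ^ 2 /\ h * V ^ 4 < 12 * x * U ^ 2 /\
  (h * V ^ 5 < 16 * x * U ^ 2 \/ 3 * h * V ^ 5 < U ^ 6) /\
  32 * x * A * s ^ 3 / U ^ 5 + 2 * s * h / U ^ 2 <= 1.

Lemma odd_difference (u v : Z) : Z.odd u = true -> Z.odd v = true ->
  exists b : Z, (v = u + 2 * b)%Z.
Proof.
  intros Hu Hv. apply Z.odd_spec in Hu, Hv. destruct Hu as [k ->], Hv as [l ->].
  exists (l - k)%Z. ring.
Qed.

Lemma gap_start_shift (x h U V : R) (a u u' : Z) :
  gap_start x h U V a u -> gap_start x h U V a u' -> (u < u')%Z ->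
  exists b : Z, (u' = u + 2 * b)%Z /\ (a <= b)%Z.
Proof.
  intros [Hu [_ Hn]] [Hu' _] Hlt.
  destruct (odd_difference u u') as [b ->]; [apply Hu|apply Hu'|].
  exists b. split; [reflexivity|]. specialize (Hn _ Hu' Hlt). lia.
Qed.

Lemma div_lt_iff (a b c : R) : 0 < b -> (a / b < c <-> a < c * b).
Proof.
  intros Hb. split; intros H.
  - apply Rmult_lt_reg_r with (/ b); [now apply Rinv_0_lt_compat|].
    replace (c * b * / b) with c by (field; lra). exact H.
  - apply Rmult_lt_reg_r with b; [assumption|].
    replace (a / b * b) with a by (field; lra). exact H.
Qed.

Lemma div_le_iff (a b c : R) : 0 < b -> (a / b <= c <-> a <= c * b).
Proof.
  intros Hb. split; intros H.
  - apply Rmult_le_reg_r with (/ b); [now apply Rinv_0_lt_compat|].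
    replace (c * b * / b) with c by (field; lra). exact H.
  - apply Rmult_le_reg_r with b; [assumption|].
    replace (a / b * b) with a by (field; lra). exact H.
Qed.

Lemma lt_div_iff (a b c : R) : 0 < b -> (c < a / b <-> c * b < a).
Proof.
  intros Hb. split; intros H.
  - apply Rmult_lt_reg_r with (/ b); [now apply Rinv_0_lt_compat|].
    replace (c * b * / b) with c by (field; lra). exact H.
  - apply Rmult_lt_reg_r with b; [assumption|].
    replace (a / b * b) with a by (field; lra). exact H.
Qed.

Lemma le_div_iff (a b c : R) : 0 < b -> (c <= a / b <-> c * b <= a).
Proof.
  intros Hb. split; intros H.
  - apply Rmult_le_reg_r with (/ b); [now apply Rinv_0_lt_compat|].
    replace (c * b * / b) with c by (field; lra). exact H.
  - apply Rmult_le_reg_r with b; [assumption|].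
    replace (a / b * b) with a by (field; lra). exact H.
Qed.

Lemma IZR_shift (u a : Z) : IZR (u + 2 * a) = IZR u + 2 * IZR a.
Proof. now rewrite plus_IZR, mult_IZR. Qed.

(** Admissibility makes the second difference of the four multipliers positive. Being an integer it
    is at least 1, and the right-hand side is its upper bound. *)
Lemma shift_product_bound (x h U V A s : R) (a b u : Z) :
  admissible x h U V A s -> (1 <= a)%Z -> (1 <= b)%Z ->
  gap_start x h U V a u -> gap_start x h U V a (u + 2 * b) ->
  1 <= 24 * x * (IZR a * IZR b) / U ^ 4 + 2 * h / U ^ 2.
Proof.
  intros [[Hx [Hh [HU [HV Hs]]]] [Ad1 [Ad2 [Ad3 Ad4]]]] Ha Hb
    [[[_ [m1 M1]] R1] [[[_ [m2 M2]] _] _]] [[[_ [m3 M3]] _] [[[_ [m4 M4]] R4] _]].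
  rewrite !IZR_shift in *. apply IZR_le in Ha, Hb.
  replace (IZR u + 2 * IZR b + 2 * IZR a) with (IZR u + 2 * IZR a + 2 * IZR b) in * by ring.
  destruct (mixed_second_difference x h (IZR u) (IZR a) (IZR b) U V
    (IZR m1) (IZR m2) (IZR m3) (IZR m4)) as [L1 L2]; try assumption; try lra.
  assert (0 < m1 - m2 - m3 + m4)%Z as Hp.
  { apply lt_IZR. rewrite plus_IZR, !minus_IZR. eapply Rle_lt_trans; [|exact L1].
    assert (1 <= IZR a * IZR b) by nra.
    assert (2 * h / U ^ 2 <= 24 * x / V ^ 4).
    { apply div_le_iff; [nra|].
      replace (24 * x / V ^ 4 * U ^ 2) with (24 * x * U ^ 2 / V ^ 4) by (field; lra).
      apply le_div_iff; [apply pow_lt; lra|]. lra. }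
    assert (0 < 24 * x / V ^ 4) by (apply Rdiv_lt_0_compat; [lra|apply pow_lt; lra]).
    replace (24 * x * (IZR a * IZR b) / V ^ 4)
      with (24 * x / V ^ 4 * (IZR a * IZR b)) by (field; lra). nra. }
  assert (1 <= m1 - m2 - m3 + m4)%Z as Hp' by lia. apply IZR_le in Hp'.
  rewrite plus_IZR, !minus_IZR in Hp'. lra.
Qed.

(** The same argument with the third difference, which contains the factor b^2 - a^2 and so requires
    [a < b]. It yields a separation uniform in [a <= A]. *)
Lemma shift_lower_bound (x h U V A s : R) (a b u : Z) :
  admissible x h U V A s -> (1 <= a)%Z -> IZR a <= A -> (a < b)%Z ->
  gap_start x h U V a u -> gap_start x h U V a (u + 2 * b) ->
  s <= IZR b.
Proof.
  intros Had Ha HA Hab G1 G2.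
  assert (Hprod := shift_product_bound x h U V A s a b u Had Ha ltac:(lia) G1 G2).
  destruct Had as [[Hx [Hh [HU [HV Hs]]]] [Ad1 [Ad2 [Ad3 Ad4]]]].
  destruct G1 as [[[_ [m1 M1]] R1] [[[_ [m2 M2]] _] _]].
  destruct G2 as [[[_ [m3 M3]] _] [[[_ [m4 M4]] R4] _]].
  assert (Hab1 : (a + 1 <= b)%Z) by lia.
  rewrite !IZR_shift in *. apply IZR_le in Ha, Hab1. rewrite plus_IZR in Hab1.
  replace (IZR u + 2 * IZR b + 2 * IZR a) with (IZR u + 2 * IZR a + 2 * IZR b) in * by ring.
  destruct (parallelogram_third_difference x h (IZR u) (IZR a) (IZR b) U V
    (IZR m1) (IZR m2) (IZR m3) (IZR m4)) as [L1 L2]; try assumption; try lra.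
  set (ra := IZR a) in *. set (rb := IZR b) in *.
  assert (HU2 : 0 < U ^ 2) by nra. assert (HU4 : 0 < U ^ 4) by (apply pow_lt; lra).
  assert (HU5 : 0 < U ^ 5) by (apply pow_lt; lra).
  assert (HV5 : 0 < V ^ 5) by (apply pow_lt; lra).
  assert (Hab2 : rb <= rb ^ 2 - ra ^ 2) by nra.
  assert (Hab3 : 1 <= ra * rb) by nra.
  assert (0 < (b + a) * (m3 - m2) - (b - a) * (m4 - m1))%Z as Hp.
  { apply lt_IZR. rewrite minus_IZR, !mult_IZR, plus_IZR, !minus_IZR. fold ra rb.
    eapply Rle_lt_trans; [|exact L1].
    (* Since b^2 - a^2 >= b cancels the factor b of the rounding term, this inequality gives
       positivity. The first alternative of [Ad3] yields it from a b >= 1; in the second, the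
       product bound first forces a b >= U^4 / (48 x). *)
    assert (Hmain : h * V ^ 5 <= 16 * x * (ra * rb) * U ^ 2).
    { destruct Ad3 as [Ad3|Ad3].
      - assert (0 < x * U ^ 2) by nra. nra.
      - assert (2 * h / U ^ 2 <= / 2) by (apply div_le_iff; lra).
        assert (/ 2 <= 24 * x * (ra * rb) / U ^ 4) as H0 by lra.
        apply le_div_iff in H0; [|assumption].
        assert (U ^ 6 = U ^ 4 * U ^ 2) by ring. nra. }
    assert (h / U ^ 2 <= 16 * x * (ra * rb) / V ^ 5).
    { apply div_le_iff; [assumption|].
      replace (16 * x * (ra * rb) / V ^ 5 * U ^ 2)
        with (16 * x * (ra * rb) * U ^ 2 / V ^ 5) by (field; lra).
      now apply le_div_iff. }
    assert (0 < x * (ra * rb) / V ^ 5) by (apply Rdiv_lt_0_compat; nra).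
    replace (32 * x * (ra * rb * (rb ^ 2 - ra ^ 2)) / V ^ 5)
      with (32 * (x * (ra * rb) / V ^ 5) * (rb ^ 2 - ra ^ 2)) by (field; lra).
    replace (16 * x * (ra * rb) / V ^ 5)
      with (16 * (x * (ra * rb) / V ^ 5)) in * by (field; lra).
    set (c := x * (ra * rb) / V ^ 5) in *.
    replace (2 * rb * h / U ^ 2) with (2 * rb * (h / U ^ 2)) by (field; lra).
    set (e := h / U ^ 2) in *.
    assert (rb * e <= rb * (16 * c)) by (apply Rmult_le_compat_l; lra).
    assert (c * rb <= c * (rb ^ 2 - ra ^ 2)) by (apply Rmult_le_compat_l; lra). lra. }
  assert (1 <= (b + a) * (m3 - m2) - (b - a) * (m4 - m1))%Z as Hp' by lia.
  apply IZR_le in Hp'. rewrite minus_IZR, !mult_IZR, plus_IZR, !minus_IZR in Hp'.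
  fold ra rb in Hp'.
  destruct (Rle_lt_dec s rb) as [Hle|Hlt]; [assumption|exfalso].
  assert (B1 : ra * rb * (rb ^ 2 - ra ^ 2) <= A * s ^ 3).
  { assert (rb ^ 2 <= s ^ 2) by nra.
    replace (ra * rb * (rb ^ 2 - ra ^ 2)) with (ra * (rb * (rb ^ 2 - ra ^ 2))) by ring.
    replace (s ^ 3) with (s * s ^ 2) by ring.
    apply Rmult_le_compat; [lra| |assumption|].
    - apply Rmult_le_pos; lra.
    - assert (0 <= ra ^ 2) by apply pow2_ge_0. apply Rmult_le_compat; lra. }
  assert (B2 : 32 * x * (ra * rb * (rb ^ 2 - ra ^ 2)) / U ^ 5 <= 32 * x * A * s ^ 3 / U ^ 5).
  { unfold Rdiv. apply Rmult_le_compat_r; [left; now apply Rinv_0_lt_compat|].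
    replace (32 * x * A * s ^ 3) with (32 * x * (A * s ^ 3)) by ring.
    apply Rmult_le_compat_l; lra. }
  assert (B3 : 2 * rb * h / U ^ 2 <= 2 * s * h / U ^ 2).
  { unfold Rdiv. apply Rmult_le_compat_r; [left; now apply Rinv_0_lt_compat|].
    apply Rmult_le_compat_r; lra. }
  lra.
Qed.

(** The product bound separates starting points by a multiple of 1/a. This serves small [a], for
    which too many starting points could share one value of D. *)
Lemma gap_count_linear (x h U V A s : R) (a : Z) :
  admissible x h U V A s -> (1 <= a)%Z ->
  atmost (gap_start x h U V a) (12 * x * (V - U) / (U ^ 2 * (U ^ 2 - 2 * h)) * IZR a + 1).
Proof.
  intros Had Ha. assert (Had' := Had).
  destruct Had' as [[Hx [Hh [HU [HV Hs]]]] [Ad1 [Ad2 [Ad3 Ad4]]]].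
  assert (Ha' := Ha). apply IZR_le in Ha'. assert (HU2 : 0 < U ^ 2) by nra.
  set (d := U ^ 2 * (U ^ 2 - 2 * h) / (12 * x * IZR a)).
  assert (Hd : 0 < d) by (unfold d; apply Rdiv_lt_0_compat; nra).
  apply atmost_le with (gap_start x h U V a) ((V - U) / d + 1); [auto| |].
  { right. unfold d. field. repeat split; try lra; nra. }
  apply atmost_spaced; [assumption|lra| |].
  - intros u [[_ H] _]. lra.
  - intros u u' G G' Hlt. destruct (gap_start_shift _ _ _ _ _ _ _ G G' Hlt) as [b [-> Hb]].
    assert (Hp := shift_product_bound x h U V A s a b u Had Ha ltac:(lia) G G').
    rewrite IZR_shift. unfold d. apply div_le_iff; [nra|].
    assert (E : 24 * x * (IZR a * IZR b) / U ^ 4 + 2 * h / U ^ 2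
      = (24 * x * (IZR a * IZR b) + 2 * h * U ^ 2) / U ^ 4) by (field; lra).
    rewrite E in Hp. apply le_div_iff in Hp; [|apply pow_lt; lra].
    assert (U ^ 4 = U ^ 2 * U ^ 2) by ring. lra.
Qed.

(** As a function of P = p (p + 2 a) the main term of D is a multiple of the convex function 1/P^2,
    which lies above its tangent at Q. Two starting points with the same D can thus be no further
    apart than 2 h / U divided by this rate of decrease. *)
Lemma cubic_main_decrease (x a p q U V : R) : 0 < x -> 0 < a -> 0 < U <= p -> p < q ->
  q + 2 * a <= V ->
  16 * x * a ^ 3 * U / V ^ 6 * (q - p)
    <= 4 * x * a ^ 3 / (p ^ 2 * (p + 2 * a) ^ 2) - 4 * x * a ^ 3 / (q ^ 2 * (q + 2 * a) ^ 2).
Proof.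
  intros Hx Ha HU Hpq HV.
  set (P := p * (p + 2 * a)). set (Q := q * (q + 2 * a)).
  assert (HP : 0 < P) by (unfold P; nra).
  assert (HQ : 4 * U * (q - p) <= 2 * (Q - P)) by (unfold P, Q; nra).
  assert (HQV : Q <= V ^ 2) by (unfold Q; nra).
  assert (HPQ : P < Q) by nra.
  replace (p ^ 2 * (p + 2 * a) ^ 2) with (P ^ 2) by (unfold P; ring).
  replace (q ^ 2 * (q + 2 * a) ^ 2) with (Q ^ 2) by (unfold Q; ring).
  assert (Ha3 : 0 < x * a ^ 3) by (apply Rmult_lt_0_compat; [lra|apply pow_lt; lra]).
  assert (H1 : 2 * (Q - P) / Q ^ 3 <= / P ^ 2 - / Q ^ 2).
  { assert (E : / P ^ 2 - / Q ^ 2 - 2 * (Q - P) / Q ^ 3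
      = (Q - P) ^ 2 * (Q + 2 * P) / (P ^ 2 * Q ^ 3)) by (field; lra).
    assert (0 <= (Q - P) ^ 2 * (Q + 2 * P) / (P ^ 2 * Q ^ 3)); [|lra].
    apply Rmult_le_pos; [apply Rmult_le_pos; nra|].
    left. apply Rinv_0_lt_compat. apply Rmult_lt_0_compat; apply pow_lt; lra. }
  assert (H2 : 4 * U * (q - p) / V ^ 6 <= 2 * (Q - P) / Q ^ 3).
  { unfold Rdiv. apply Rmult_le_compat; [nra| |assumption|].
    - left. apply Rinv_0_lt_compat, pow_lt. lra.
    - apply Rinv_le_contravar; [apply pow_lt; lra|].
      replace (V ^ 6) with ((V ^ 2) ^ 3) by ring. apply pow_incr. lra. }
  replace (16 * x * a ^ 3 * U / V ^ 6 * (q - p))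
    with (4 * (x * a ^ 3) * (4 * U * (q - p) / V ^ 6)) by (field; lra).
  replace (4 * x * a ^ 3 / P ^ 2 - 4 * x * a ^ 3 / Q ^ 2)
    with (4 * (x * a ^ 3) * (/ P ^ 2 - / Q ^ 2)) by (field; lra).
  apply Rmult_le_compat_l; lra.
Qed.

(** A choice of multiplier makes D a function of the starting point, whose fibres can be counted;
    away from hits its value is arbitrary. *)
Definition multiplier (x h : R) (u : Z) : Z :=
  epsilon (inhabits 0%Z) (fun m => x < IZR m * IZR u ^ 2 <= x + h).

Lemma multiplier_spec (x h : R) (u : Z) : hit x h u ->
  x < IZR (multiplier x h u) * IZR u ^ 2 <= x + h.
Proof. intros [_ H]. exact (epsilon_spec _ _ H). Qed.

Definition cubic_value (x h : R) (a u : Z) : Z :=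
  ((a - u) * multiplier x h u + (u + 3 * a) * multiplier x h (u + 2 * a))%Z.

Lemma cubic_value_near (x h U V : R) (a u : Z) :
  0 < h -> 0 < U -> V <= 2 * U -> (1 <= a)%Z ->
  gap_start x h U V a u ->
  Rabs (IZR (cubic_value x h a u)
    - 4 * x * IZR a ^ 3 / (IZR u ^ 2 * (IZR u + 2 * IZR a) ^ 2)) < h / U.
Proof.
  intros Hh HU HV Ha [[H1 R1] [[H2 R2] _]].
  apply multiplier_spec in H1, H2. unfold cubic_value.
  rewrite IZR_shift in *. apply IZR_le in Ha.
  rewrite plus_IZR, !mult_IZR, minus_IZR, plus_IZR, mult_IZR.
  eapply Rlt_le_trans; [apply cubic_combination with (h := h); lra|].
  unfold Rdiv. apply Rmult_le_compat_l; [lra|]. apply Rinv_le_contravar; lra.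
Qed.

(** The first factor counts the possible values of D. The second counts the starting points with one
    value: they span a bounded length, in which any two non-adjacent ones are at least [2 * s]
    apart. *)
Lemma gap_count_cubic (x h U V A s : R) (a : Z) :
  admissible x h U V A s -> (1 <= a)%Z -> IZR a <= A ->
  atmost (gap_start x h U V a)
    ((4 * x * IZR a ^ 3 * (/ U ^ 4 - / V ^ 4) + 2 * h / U + 1)
      * ((h * V ^ 6 / (8 * x * IZR a ^ 3 * U ^ 2) / (2 * s) + 1) * 2)).
Proof.
  intros Had Ha HA. assert (Had' := Had).
  destruct Had' as [[Hx [Hh [HU [HV Hs]]]] [Ad1 [Ad2 [Ad3 Ad4]]]].
  assert (Ha' := Ha). apply IZR_le in Ha'.
  set (ra := IZR a) in *.
  assert (Ha3 : 0 < x * ra ^ 3) by (apply Rmult_lt_0_compat; [lra|apply pow_lt; lra]).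
  assert (HU4 : 0 < U ^ 4) by (apply pow_lt; lra).
  assert (HV4 : 0 < V ^ 4) by (apply pow_lt; lra).
  assert (HV6 : 0 < V ^ 6) by (apply pow_lt; lra).
  assert (HUV : U ^ 4 <= V ^ 4) by (apply pow_incr; lra).
  assert (HhU : 0 < h / U) by (apply Rdiv_lt_0_compat; lra).
  set (len := h * V ^ 6 / (8 * x * ra ^ 3 * U ^ 2)).
  assert (Hlen : 0 < len).
  { unfold len. apply Rdiv_lt_0_compat; [apply Rmult_lt_0_compat; lra|].
    apply Rmult_lt_0_compat; [lra|]. apply pow_lt. lra. }
  set (p := 4 * x * ra ^ 3 / V ^ 4 - h / U). set (q := 4 * x * ra ^ 3 / U ^ 4 + h / U).
  assert (Hpq : p <= q).
  { assert (4 * x * ra ^ 3 / V ^ 4 <= 4 * x * ra ^ 3 / U ^ 4).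
    { unfold Rdiv. apply Rmult_le_compat_l; [lra|]. now apply Rinv_le_contravar. }
    unfold p, q. lra. }
  assert (Hfac : 0 <= (len / (2 * s) + 1) * 2).
  { assert (0 < len / (2 * s)) by (apply Rdiv_lt_0_compat; lra). lra. }
  apply atmost_le with (gap_start x h U V a) ((q - p + 1) * ((len / (2 * s) + 1) * 2));
    [auto| |].
  { right. f_equal. unfold p, q. field. repeat split; lra. }
  assert (Hnear : forall u, gap_start x h U V a u ->
    Rabs (IZR (cubic_value x h a u)
      - 4 * x * ra ^ 3 / (IZR u ^ 2 * (IZR u + 2 * ra) ^ 2)) < h / U).
  { intros u Hu. apply cubic_value_near with V; try assumption; lra. }
  assert (Hrange : forall u, gap_start x h U V a u ->
    U <= IZR u /\ IZR u + 2 * ra <= V).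
  { intros u [[_ H1] [[_ H2] _]]. rewrite IZR_shift in H2. fold ra in H2. lra. }
  apply atmost_fibres with (cubic_value x h a); try assumption.
  - intros u Hu. specialize (Hnear u Hu). destruct (Hrange u Hu) as [R1 R2].
    apply Rabs_def2 in Hnear.
    assert (0 < IZR u ^ 2 * (IZR u + 2 * ra) ^ 2).
    { apply Rmult_lt_0_compat; apply pow_lt; lra. }
    assert (U ^ 4 <= IZR u ^ 2 * (IZR u + 2 * ra) ^ 2 <= V ^ 4).
    { replace (U ^ 4) with (U ^ 2 * U ^ 2) by ring. replace (V ^ 4) with (V ^ 2 * V ^ 2) by ring.
      split; apply Rmult_le_compat; try (apply pow_le; lra); apply pow_incr; lra. }
    assert (4 * x * ra ^ 3 / V ^ 4 <= 4 * x * ra ^ 3 / (IZR u ^ 2 * (IZR u + 2 * ra) ^ 2)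
      <= 4 * x * ra ^ 3 / U ^ 4).
    { unfold Rdiv. split; (apply Rmult_le_compat_l; [lra|]); apply Rinv_le_contravar; lra. }
    unfold p, q. lra.
  - intros d. apply atmost_diameter with len; [assumption| |].
    + intros u u' [Hu Du] [Hu' Du'].
      destruct (Rle_lt_dec (IZR u') (IZR u)) as [Hle|Hlt]; [lra|].
      assert (N1 := Hnear u Hu). assert (N2 := Hnear u' Hu'). rewrite Du in N1. rewrite Du' in N2.
      apply Rabs_def2 in N1, N2.
      destruct (Hrange u Hu) as [R1 R2]. destruct (Hrange u' Hu') as [R3 R4].
      assert (M := cubic_main_decrease x ra (IZR u) (IZR u') U V Hx ltac:(lra) ltac:(lra) Hlt R4).
      set (c := 16 * x * ra ^ 3 * U / V ^ 6) in *.
      assert (Hc : 0 < c).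
      { unfold c. apply Rdiv_lt_0_compat; [|assumption]. apply Rmult_lt_0_compat; lra. }
      apply Rmult_le_reg_l with c; [assumption|].
      replace (c * len) with (2 * (h / U)); [lra|]. unfold c, len. field. repeat split; lra.
    + intros r0. replace (len / (2 * s)) with ((r0 + len - r0) / (2 * s)) by (f_equal; ring).
      apply atmost_spaced3; [lra|lra|tauto|].
      intros z z' z'' [[G _] _] [[G' _] _] [[G'' _] _] [L1 L2].
      destruct (gap_start_shift _ _ _ _ _ _ _ G G' L1) as [b1 [E1 B1]].
      destruct (gap_start_shift _ _ _ _ _ _ _ G' G'' L2) as [b2 [E2 B2]].
      (* Both [b1] and [b2] are at least [a >= 1], so their sum exceeds [a] strictly, as the third
         difference requires. *)
      assert (E : z'' = (z + 2 * (b1 + b2))%Z) by lia. rewrite E in *.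
      assert (s <= IZR (b1 + b2)).
      { apply shift_lower_bound with x h U V A a z; try assumption; lia. }
      rewrite IZR_shift. lra.
Qed.

(** * Hits in a window *)

Lemma nat_least (P : nat -> Prop) : (exists k, P k) ->
  exists k, P k /\ forall j, P j -> (k <= j)%nat.
Proof.
  intros [k Hk]. revert Hk. induction k as [k IH] using (well_founded_induction lt_wf). intros Hk.
  destruct (excluded_middle_informative (exists j, (j < k)%nat /\ P j)) as [[j [Hj HP]]|Hno].
  - now apply (IH j).
  - exists k. split; [assumption|]. intros j Hj.
    destruct (le_lt_dec k j) as [H|H]; [assumption|]. exfalso. apply Hno. now exists j.
Qed.

Lemma rsum_cubes (n : nat) :
  rsum (fun k => INR (S k) ^ 3) n = (INR n * (INR n + 1) / 2) ^ 2.
Proof.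
  induction n as [|n IH]; [simpl; field|].
  change (rsum (fun k => INR (S k) ^ 3) (S n))
    with (rsum (fun k => INR (S k) ^ 3) n + INR (S n) ^ 3).
  rewrite IH, S_INR. field.
Qed.

(** Telescoping of k <= k^2 - (k - 1)^2; the minimum with n^2 is the strengthened induction
    hypothesis. *)
Lemma rsum_small (B : R) (n : nat) : 0 < B ->
  rsum (fun k => if Rlt_dec (INR (S k) ^ 2) B then INR (S k) else 0) n <= B.
Proof.
  intros HB.
  assert (H : rsum (fun k => if Rlt_dec (INR (S k) ^ 2) B then INR (S k) else 0) n
    <= Rmin (INR n ^ 2) B).
  { induction n as [|n IH]; cbn [rsum]; [apply Rmin_glb; simpl; lra|].
    assert (H1 := Rmin_l (INR n ^ 2) B). assert (H2 := Rmin_r (INR n ^ 2) B).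
    assert (Hn := pos_INR n). destruct (Rlt_dec (INR (S n) ^ 2) B) as [H|H].
    - apply Rmin_glb; rewrite S_INR in *; nra.
    - apply Rmin_glb; rewrite ?S_INR; nra. }
  eapply Rle_trans; [exact H|apply Rmin_r].
Qed.

Lemma rsum_none_small (B : R) (n : nat) : B <= 1 ->
  rsum (fun k => if Rlt_dec (INR (S k) ^ 2) B then INR (S k) else 0) n = 0.
Proof.
  intros HB. induction n as [|n IH]; [reflexivity|]. cbn [rsum]. rewrite IH.
  destruct (Rlt_dec (INR (S n) ^ 2) B) as [H|H]; [|lra].
  exfalso. rewrite S_INR in H. assert (Hn := pos_INR n). nra.
Qed.

(** Telescoping of 1/z^3 <= (4/3) (1/z^2 - 1/(z+1)^2), an equality at z = 1, which fixes the
    constant 4/3. The maximum with 0 covers the indices before the tail begins. *)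
Lemma rsum_inverse_cube_tail (B : R) (n : nat) : 0 < B ->
  rsum (fun k => if Rlt_dec (INR (S k) ^ 2) B then 0 else / INR (S k) ^ 3) n <= 4 / 3 / B.
Proof.
  intros HB.
  assert (H : rsum (fun k => if Rlt_dec (INR (S k) ^ 2) B then 0 else / INR (S k) ^ 3) n
    <= Rmax 0 (4 / 3 * (/ B - / INR (S n) ^ 2))).
  { induction n as [|n IH]; cbn [rsum]; [apply Rmax_l|].
    set (z := INR (S n)) in *.
    assert (Hz : 1 <= z) by (unfold z; rewrite S_INR; assert (Hn := pos_INR n); lra).
    assert (Hz' : INR (S (S n)) = z + 1) by apply S_INR. rewrite Hz'.
    assert (I1 : 0 < / z ^ 2) by (apply Rinv_0_lt_compat, pow_lt; lra).
    assert (D : / z ^ 3 <= 4 / 3 * (/ z ^ 2 - / (z + 1) ^ 2)).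
    { assert (E : 4 / 3 * (/ z ^ 2 - / (z + 1) ^ 2) - / z ^ 3
        = (5 * z ^ 2 - 2 * z - 3) / (3 * z ^ 3 * (z + 1) ^ 2)) by (field; lra).
      assert (0 <= (5 * z ^ 2 - 2 * z - 3) / (3 * z ^ 3 * (z + 1) ^ 2)); [|lra].
      apply Rmult_le_pos; [nra|]. left. apply Rinv_0_lt_compat.
      apply Rmult_lt_0_compat; [apply Rmult_lt_0_compat; [lra|]|]; apply pow_lt; lra. }
    assert (I3 : / (z + 1) ^ 2 <= / z ^ 2).
    { apply Rinv_le_contravar; [apply pow_lt; lra|apply pow_incr; lra]. }
    destruct (Rlt_dec (z ^ 2) B) as [Hlt|Hge].
    - rewrite Rplus_0_r. eapply Rle_trans; [exact IH|]. apply Rle_max_compat_l. lra.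
    - assert (I2 : / z ^ 2 <= / B) by (apply Rinv_le_contravar; lra).
      rewrite Rmax_right in IH by lra. eapply Rle_trans; [|apply Rmax_r]. lra. }
  eapply Rle_trans; [exact H|]. unfold Rdiv. rewrite Rmult_assoc. apply Rmax_lub.
  - assert (0 < / B) by now apply Rinv_0_lt_compat. lra.
  - assert (0 < / INR (S n) ^ 2); [|lra]. apply Rinv_0_lt_compat, pow_lt, lt_0_INR. lia.
Qed.

(** A hit without successor within [2 * A], such as the last one of the window, is counted by
    spacing. Any other hit starts a gap with half-length at most [n]. *)
Lemma window_cover (x h U V A : R) (n : nat) (r : nat -> R) :
  0 < A -> U < V -> A < INR n + 1 ->
  (forall k, (k < n)%nat -> atmost (gap_start x h U V (Z.of_nat (S k))) (r k)) ->
  atmost (window_hit x h U V) ((V - U) / (2 * A) + 1 + rsum r n).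
Proof.
  intros HA HUV Hn Hr.
  apply atmost_le with (fun u =>
    (window_hit x h U V u /\
       forall v, window_hit x h U V v -> (u < v)%Z -> 2 * A < IZR v - IZR u) \/
    exists k, (k < n)%nat /\ gap_start x h U V (Z.of_nat (S k)) u)
    ((V - U) / (2 * A) + 1 + rsum r n); [|lra|].
  - intros u Hu.
    destruct (excluded_middle_informative (forall v, window_hit x h U V v -> (u < v)%Z ->
      2 * A < IZR v - IZR u)) as [H|H]; [now left|right].
    destruct (nat_least (fun k => window_hit x h U V (u + 2 * Z.of_nat (S k)))) as [k [Hk Hmin]].
    + apply NNPP. intros Hno. apply H. intros v Hv Huv. exfalso. apply Hno.
      destruct (odd_difference u v) as [b ->]; [apply Hu|apply Hv|].
      exists (Z.to_nat (b - 1)). replace (Z.of_nat (S (Z.to_nat (b - 1)))) with b by lia.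
      assumption.
    + assert (Hnext : forall v, window_hit x h U V v -> (u < v)%Z ->
        (u + 2 * Z.of_nat (S k) <= v)%Z).
      { intros v Hv Huv. destruct (odd_difference u v) as [b ->]; [apply Hu|apply Hv|].
        assert (k <= Z.to_nat (b - 1))%nat; [|lia]. apply Hmin.
        now replace (Z.of_nat (S (Z.to_nat (b - 1)))) with b by lia. }
      exists k. split; [|now split].
      destruct (le_lt_dec n k) as [Hnk|]; [exfalso|assumption].
      apply H. intros v Hv Huv. specialize (Hnext v Hv Huv). apply IZR_le in Hnext.
      rewrite IZR_shift, <- INR_IZR_INZ, S_INR in Hnext. apply le_INR in Hnk. lra.
  - apply atmost_or.
    + apply atmost_spaced; [lra|lra| |].
      * intros u [[_ H] _]. lra.
      * intros u u' [_ H] [Hu' _] Hlt. specialize (H u' Hu' Hlt). lra.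
    + apply atmost_cover with (fun k => gap_start x h U V (Z.of_nat (S k))); auto.
Qed.

(* Half-gaps [a] with [a^2 < B] are counted by [gap_count_linear], the others by [gap_count_cubic]; if [B <= 1] the first kind is absent. *)
Lemma window_count (x h U V A s B P : R) :
  admissible x h U V A s -> 0 < A -> 0 < B -> 0 <= P ->
  (1 < B -> 12 * x * (V - U) / (U ^ 2 * (U ^ 2 - 2 * h)) * B <= P) ->
  atmost (window_hit x h U V)
    ((V - U) / (2 * A) + 1
      + A * (2 + 4 * h / U + (/ U ^ 4 - / V ^ 4) * (h * V ^ 6 / (2 * U ^ 2 * s)))
      + 2 * x * (/ U ^ 4 - / V ^ 4) * (A * (A + 1)) ^ 2
      + P + 4 / 3 / B * ((2 * h / U + 1) * (h * V ^ 6 / (8 * x * U ^ 2 * s)))).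
Proof.
  intros Had HA HB HP HBP. assert (Had' := Had).
  destruct Had' as [[Hx [Hh [HU [HV Hs]]]] [Ad1 [Ad2 [Ad3 Ad4]]]].
  assert (HU2 : 0 < U ^ 2) by nra.
  assert (HU4 : 0 < U ^ 4) by (apply pow_lt; lra).
  assert (HV4 : 0 < V ^ 4) by (apply pow_lt; lra).
  assert (HV6 : 0 < V ^ 6) by (apply pow_lt; lra).
  set (dl := / U ^ 4 - / V ^ 4).
  assert (Hdl : 0 <= dl).
  { assert (/ V ^ 4 <= / U ^ 4); [|unfold dl; lra].
    apply Rinv_le_contravar; [assumption|apply pow_incr; lra]. }
  assert (HhU : 0 < h / U) by (apply Rdiv_lt_0_compat; lra).
  set (p := 12 * x * (V - U) / (U ^ 2 * (U ^ 2 - 2 * h))) in *.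
  assert (Hp : 0 <= p) by (unfold p; left; apply Rdiv_lt_0_compat; nra).
  set (q := (2 * h / U + 1) * (h * V ^ 6 / (8 * x * U ^ 2 * s))).
  assert (Hq : 0 <= q).
  { unfold q. apply Rmult_le_pos; [unfold Rdiv in *; lra|].
    left. apply Rdiv_lt_0_compat; [nra|]. repeat (apply Rmult_lt_0_compat; try lra). }
  set (c := dl * (h * V ^ 6 / (2 * U ^ 2 * s))).
  assert (Hc : 0 <= c).
  { unfold c. apply Rmult_le_pos; [assumption|].
    left. apply Rdiv_lt_0_compat; [nra|]. repeat (apply Rmult_lt_0_compat; try lra). }
  set (C0 := 2 + 4 * h / U + c).
  assert (HC0 : 2 <= C0) by (unfold C0, Rdiv in *; lra).
  set (n := Z.to_nat (Int_part A)).
  assert (HnA : INR n <= A < INR n + 1).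
  { destruct (base_Int_part A) as [H1 H2].
    assert (0 <= Int_part A)%Z.
    { assert (-1 < Int_part A)%Z; [|lia]. apply lt_IZR. lra. }
    unfold n. rewrite INR_IZR_INZ, Z2Nat.id by assumption. lra. }
  (* Expanding the product in [gap_count_cubic] gives a constant, a cubic and an inverse cubic term
     in [a = S k]. Only the last is a burden for small [a], so there the linear count takes its
     place; [C0 >= 2] covers the [+ 1] of that count. *)
  set (r := fun k => C0 + 8 * x * dl * INR (S k) ^ 3
    + (p * (if Rlt_dec (INR (S k) ^ 2) B then INR (S k) else 0)
       + q * (if Rlt_dec (INR (S k) ^ 2) B then 0 else / INR (S k) ^ 3))).
  apply atmost_le with (window_hit x h U V) ((V - U) / (2 * A) + 1 + rsum r n); [auto| |].
  - unfold r. rewrite !rsum_plus, !rsum_scal, rsum_const, rsum_cubes.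
    assert (S1 : INR n * C0 <= A * C0) by (apply Rmult_le_compat_r; lra).
    assert (Hn := pos_INR n).
    assert (S2 : (INR n * (INR n + 1) / 2) ^ 2 <= (A * (A + 1) / 2) ^ 2).
    { apply pow_incr. split; [nra|]. apply Rmult_le_compat_r; [lra|].
      apply Rmult_le_compat; lra. }
    assert (S3 : 8 * x * dl * (INR n * (INR n + 1) / 2) ^ 2 <= 2 * x * dl * (A * (A + 1)) ^ 2).
    { replace (2 * x * dl * (A * (A + 1)) ^ 2) with (8 * x * dl * (A * (A + 1) / 2) ^ 2) by field.
      apply Rmult_le_compat_l; [|assumption]. apply Rmult_le_pos; lra. }
    assert (S4 : p * rsum (fun k => if Rlt_dec (INR (S k) ^ 2) B then INR (S k) else 0) n <= P).
    { destruct (Rle_lt_dec B 1) as [H|H].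
      - rewrite rsum_none_small by assumption. lra.
      - eapply Rle_trans; [|apply (HBP H)]. apply Rmult_le_compat_l; [assumption|].
        now apply rsum_small. }
    assert (S5 : q * rsum (fun k => if Rlt_dec (INR (S k) ^ 2) B then 0 else / INR (S k) ^ 3) n
      <= 4 / 3 / B * q).
    { rewrite (Rmult_comm _ q). apply Rmult_le_compat_l; [assumption|].
      now apply rsum_inverse_cube_tail. }
    lra.
  - apply window_cover; [assumption|lra|lra|]. intros k Hk.
    assert (Ek : IZR (Z.of_nat (S k)) = INR (S k)) by now rewrite <- INR_IZR_INZ.
    assert (Hk1 : (1 <= Z.of_nat (S k))%Z) by lia.
    set (ra := INR (S k)) in *.
    assert (Hra : 1 <= ra) by (rewrite <- Ek; now apply IZR_le).
    assert (HkA : IZR (Z.of_nat (S k)) <= A).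
    { rewrite Ek. apply Rle_trans with (INR n); [|lra]. apply le_INR. lia. }
    assert (Hra3 : 0 < ra ^ 3) by (apply pow_lt; lra).
    assert (Hcube : 0 <= 8 * x * dl * ra ^ 3).
    { repeat (apply Rmult_le_pos; try lra). }
    unfold r. fold ra. destruct (Rlt_dec (ra ^ 2) B) as [Hlt|Hge].
    + eapply atmost_le; [intros z Hz; exact Hz| |
        exact (gap_count_linear x h U V A s _ Had Hk1)].
      rewrite Ek. fold p. lra.
    + eapply atmost_le; [intros z Hz; exact Hz| |
        exact (gap_count_cubic x h U V A s _ Had Hk1 HkA)].
      rewrite Ek. fold dl. right. unfold C0, c, q. field. repeat split; lra.
Qed.

(** A bootstrap: the first difference [m1 - m2] is a positive integer, which already forces a >= U^3
    / (8 x). Then the main term of D exceeds its error, so D >= 1, and this in turn forces a >=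
    G. *)
Lemma sparse_window_count (x h U V G : R) :
  0 < x -> 0 < h -> 0 < U < V -> V <= 2 * U -> 0 < G -> 2 * h <= U ^ 2 ->
  h * V ^ 3 < 4 * x * U ^ 2 -> 128 * h * x ^ 2 * V ^ 4 < U ^ 10 ->
  4 * x * G ^ 3 / U ^ 4 + h / U <= 1 ->
  atmost (window_hit x h U V) ((V - U) / (2 * G) + 1).
Proof.
  intros Hx Hh HU HV HG H1 H2 H3 H4.
  apply atmost_spaced; [lra|lra| |].
  - intros u [_ H]. lra.
  - intros u v [Hu Ru] [Hv Rv] Hlt.
    destruct (odd_difference u v) as [a ->]; [apply Hu|apply Hv|].
    destruct Hu as [_ [m1 M1]], Hv as [_ [m2 M2]]. rewrite IZR_shift in *.
    assert (Ha : (1 <= a)%Z) by lia. apply IZR_le in Ha.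
    set (t := IZR u) in *.
    assert (HU2 : 0 < U ^ 2) by nra. assert (HU3 : 0 < U ^ 3) by (apply pow_lt; lra).
    assert (HU4 : 0 < U ^ 4) by (apply pow_lt; lra).
    assert (HV3 : 0 < V ^ 3) by (apply pow_lt; lra).
    assert (HV4 : 0 < V ^ 4) by (apply pow_lt; lra).
    assert (C := cubic_combination x h t (IZR a) (IZR m1) (IZR m2) Hh ltac:(lra) M1 M2).
    apply Rabs_def2 in C.
    destruct (near_inverse_square x h t (IZR m1) U) as [e1 [E1 B1]]; try lra.
    destruct (near_inverse_square x h (t + 2 * IZR a) (IZR m2) U) as [e2 [E2 B2]]; try lra.
    assert (K1 := prod_inv_bounds U V [t; t; t + 2 * IZR a] ltac:(lra)).
    assert (K2 := prod_inv_bounds U V [t; t + 2 * IZR a; t + 2 * IZR a] ltac:(lra)).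
    lapply K1; [clear K1; intros K1|intros z [<-|[<-|[<-|[]]]]; lra].
    lapply K2; [clear K2; intros K2|intros z [<-|[<-|[<-|[]]]]; lra].
    cbn [length fold_right] in K1, K2.
    match type of K1 with _ <= ?a <= _ => set (f1 := a) in * end.
    match type of K2 with _ <= ?a <= _ => set (f2 := a) in * end.
    assert (F : x / t ^ 2 - x / (t + 2 * IZR a) ^ 2 = 2 * x * IZR a * (f1 + f2)).
    { unfold f1, f2. field. lra. }
    assert (0 < x * IZR a) by (apply Rmult_lt_0_compat; lra).
    assert (F' : 2 * x * IZR a * (2 * / V ^ 3) <= 2 * x * IZR a * (f1 + f2)
      <= 2 * x * IZR a * (2 * / U ^ 3)) by (split; apply Rmult_le_compat_l; lra).
    assert (Hd : (1 <= m1 - m2)%Z).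
    { assert (0 < m1 - m2)%Z; [|lia]. apply lt_IZR. rewrite minus_IZR.
      assert (h / U ^ 2 < 4 * x / V ^ 3).
      { apply div_lt_iff; [assumption|].
        replace (4 * x / V ^ 3 * U ^ 2) with (4 * x * U ^ 2 / V ^ 3) by (field; lra).
        apply lt_div_iff; assumption. }
      assert (0 < / V ^ 3) by now apply Rinv_0_lt_compat.
      assert (4 * x / V ^ 3 <= 2 * x * IZR a * (2 * / V ^ 3)).
      { replace (2 * x * IZR a * (2 * / V ^ 3)) with (4 * x * IZR a / V ^ 3) by (field; lra).
        unfold Rdiv. apply Rmult_le_compat_r; [lra|]. nra. }
      lra. }
    apply IZR_le in Hd. rewrite minus_IZR in Hd.
    assert (h / U ^ 2 <= / 2) by (apply div_le_iff; lra).
    assert (A1 : / 2 <= 4 * x * IZR a / U ^ 3) by (unfold Rdiv; lra).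
    apply le_div_iff in A1; [|assumption].
    assert (A2 : U ^ 3 / (8 * x) <= IZR a) by (apply div_le_iff; lra).
    assert (A3 : (U ^ 3 / (8 * x)) ^ 3 <= IZR a ^ 3).
    { apply pow_incr. split; [|assumption]. left. apply Rdiv_lt_0_compat; lra. }
    set (W := t ^ 2 * (t + 2 * IZR a) ^ 2) in *.
    assert (HW : U ^ 4 <= W <= V ^ 4).
    { unfold W. replace (U ^ 4) with (U ^ 2 * U ^ 2) by ring.
      replace (V ^ 4) with (V ^ 2 * V ^ 2) by ring.
      split; apply Rmult_le_compat; try (apply pow_le; lra); apply pow_incr; lra. }
    set (D := ((a - u) * m1 + (u + 3 * a) * m2)%Z).
    assert (ED : IZR D = (IZR a - t) * IZR m1 + (t + 3 * IZR a) * IZR m2).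
    { unfold D, t. now rewrite plus_IZR, !mult_IZR, minus_IZR, plus_IZR, mult_IZR. }
    rewrite <- ED in C.
    assert (Ht : h / t <= h / U).
    { unfold Rdiv. apply Rmult_le_compat_l; [lra|]. apply Rinv_le_contravar; lra. }
    assert (Ha3 : 0 < x * IZR a ^ 3) by (apply Rmult_lt_0_compat; [lra|apply pow_lt; lra]).
    assert (D1 : (1 <= D)%Z).
    { assert (0 < D)%Z; [|lia]. apply lt_IZR.
      assert (L1 : h / U < 4 * x * IZR a ^ 3 / V ^ 4).
      { apply div_lt_iff; [lra|].
        replace (4 * x * IZR a ^ 3 / V ^ 4 * U) with (4 * x * IZR a ^ 3 * U / V ^ 4) by (field; lra).
        apply lt_div_iff; [assumption|].
        apply Rlt_le_trans with (4 * x * (U ^ 3 / (8 * x)) ^ 3 * U).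
        - replace (4 * x * (U ^ 3 / (8 * x)) ^ 3 * U) with (U ^ 10 / (128 * x ^ 2)) by (field; lra).
          apply lt_div_iff; [|lra]. assert (0 < x ^ 2) by (apply pow_lt; lra). lra.
        - apply Rmult_le_compat_r; [lra|]. apply Rmult_le_compat_l; lra. }
      assert (L2 : 4 * x * IZR a ^ 3 / V ^ 4 <= 4 * x * IZR a ^ 3 / W).
      { unfold Rdiv. apply Rmult_le_compat_l; [lra|]. apply Rinv_le_contravar; lra. }
      lra. }
    apply IZR_le in D1.
    assert (L3 : 4 * x * IZR a ^ 3 / W <= 4 * x * IZR a ^ 3 / U ^ 4).
    { unfold Rdiv. apply Rmult_le_compat_l; [lra|]. apply Rinv_le_contravar; lra. }
    destruct (Rle_lt_dec G (IZR a)) as [Hle|Hlt']; [lra|exfalso].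
    assert (IZR a ^ 3 <= G ^ 3) by (apply pow_incr; lra).
    assert (4 * x * IZR a ^ 3 / U ^ 4 <= 4 * x * G ^ 3 / U ^ 4).
    { unfold Rdiv. apply Rmult_le_compat_r; [left; now apply Rinv_0_lt_compat|].
      apply Rmult_le_compat_l; lra. }
    lra.
Qed.

(** * Reduction to counting hits *)

Lemma atmost_interval_lower (x h r : R) :
  atmost (fun n => x < IZR n <= x + h) r -> h - 1 <= r.
Proof.
  intros H. set (N := Z.to_nat (up (x + h) - up x)).
  destruct (archimed x) as [U1 U2]. destruct (archimed (x + h)) as [V1 V2].
  assert (HN : h - 1 <= INR N).
  { unfold N. destruct (Z_le_gt_dec 0 (up (x + h) - up x)) as [Hz|Hz].
    - rewrite INR_IZR_INZ, Z2Nat.id by assumption. rewrite minus_IZR. lra.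
    - assert (IZR (up (x + h)) <= IZR (up x)) by (apply IZR_le; lia).
      assert (Hp := pos_INR (Z.to_nat (up (x + h) - up x))). lra. }
  apply Rle_trans with (INR N); [assumption|].
  rewrite <- (length_seq N 0), <- (length_map (fun k => up x + Z.of_nat k)%Z). apply H.
  - apply Injective_map_NoDup; [|apply seq_NoDup]. intros i j Hij. lia.
  - intros z Hz. apply in_map_iff in Hz. destruct Hz as [k [<- Hk]]. apply in_seq in Hk.
    assert (up x + Z.of_nat k <= up (x + h) - 1)%Z as H1 by (unfold N in Hk; lia).
    assert (up x <= up x + Z.of_nat k)%Z as H2 by lia.
    apply IZR_le in H1, H2. rewrite minus_IZR in H1. lra.
Qed.

Lemma atmost_multiples (x h : R) (d : Z) : 0 <= h -> (0 < d)%Z ->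
  atmost (fun n => x < IZR n <= x + h /\ (d | n)%Z) (h / IZR d + 1).
Proof.
  intros Hh Hd. assert (Hd' := Hd). apply IZR_lt in Hd'.
  replace (h / IZR d) with ((x + h - x) / IZR d) by (f_equal; ring).
  apply atmost_spaced; [assumption|lra| |].
  - intros z [Hz _]. lra.
  - intros z z' [_ [k ->]] [_ [k' ->]] Hlt. rewrite <- minus_IZR. apply IZR_le.
    assert (k < k')%Z by nia. nia.
Qed.

(** Telescoping, since (2 k + 3)^2 exceeds 4 (k + 1) (k + 2) by 1. *)
Lemma rsum_odd_squares (n : nat) :
  rsum (fun k => / (2 * INR k + 3) ^ 2) n <= / 4 - / (4 * (INR n + 1)).
Proof.
  induction n as [|n IH]; [simpl; lra|]. cbn [rsum]. rewrite S_INR.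
  assert (Hn := pos_INR n). set (z := INR n) in *.
  assert (/ (2 * z + 3) ^ 2 <= / (4 * ((z + 1) * (z + 2)))) by (apply Rinv_le_contravar; nra).
  assert (/ (4 * ((z + 1) * (z + 2))) = / (4 * (z + 1)) - / (4 * (z + 1 + 1))) by (field; lra).
  lra.
Qed.

Lemma prime_two_or_odd (p : Z) : prime p -> p = 2%Z \/ Z.odd p = true.
Proof.
  intros Hp. destruct (Z.odd p) eqn:E; [now right|left].
  rewrite <- Z.negb_even in E. apply Bool.negb_false_iff, Z.even_spec in E.
  destruct E as [k Hk].
  destruct (prime_divisors p Hp 2) as [H|[H|[H|H]]]; [exists k; lia|lia|lia|lia|].
  assert (H2 := prime_ge_2 p Hp). lia.
Qed.

(** Below [h / 8] all odd moduli are taken, prime or not, so that their number and the sum of their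
    inverse squares are elementary. From [h / 8] on, [64 < h] gives p^2 > h, so each p has at most
    one multiple of p^2 in the interval and the transfer from n to p is injective. *)
Lemma squarefree_free_interval (x h r : R) :
  0 < x -> 64 < h ->
  (forall n : Z, x < IZR n <= x + h -> ~ squarefree n) ->
  atmost (fun u => hit x h u /\ h / 8 <= IZR u) r ->
  7 / 16 * h - 2 <= r.
Proof.
  intros Hx Hh Hno Hr.
  set (K := Z.to_nat (up ((h / 8 - 3) / 2))).
  destruct (archimed ((h / 8 - 3) / 2)) as [U1 U2].
  assert (HK : INR K <= h / 16).
  { unfold K. destruct (Z_le_gt_dec 0 (up ((h / 8 - 3) / 2))) as [H|H].
    - rewrite INR_IZR_INZ, Z2Nat.id by assumption. lra.
    - replace (Z.to_nat (up ((h / 8 - 3) / 2))) with O by lia. simpl. lra. }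
  set (I := fun n => x < IZR n <= x + h).
  assert (H : atmost I (h / 4 + 1
    + (rsum (fun k => h / IZR ((2 * Z.of_nat k + 3) ^ 2) + 1) K + r))).
  { apply atmost_le with (fun n => (I n /\ (4 | n)%Z) \/
      ((exists k, (k < K)%nat /\ I n /\ ((2 * Z.of_nat k + 3) ^ 2 | n)%Z) \/
       (I n /\ exists p, (p ^ 2 | n)%Z /\ Z.odd p = true /\ h / 8 <= IZR p)))
      (h / 4 + 1 + (rsum (fun k => h / IZR ((2 * Z.of_nat k + 3) ^ 2) + 1) K + r)); [|lra|].
    - intros n Hn. specialize (Hno n Hn).
      assert (exists p, prime p /\ (p ^ 2 | n)%Z) as [p [Hp Hpn]].
      { apply NNPP. intros H. apply Hno. intros p Hp Hd. apply H. now exists p. }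
      assert (H2 := prime_ge_2 p Hp).
      destruct (prime_two_or_odd p Hp) as [->|Hodd]; [now left|right].
      destruct (Rle_lt_dec (h / 8) (IZR p)) as [Hle|Hlt].
      + right. split; [assumption|]. now exists p.
      + left. assert (Hodd' := Hodd). apply Z.odd_spec in Hodd'. destruct Hodd' as [j Hj].
        exists (Z.to_nat (j - 1)).
        replace (2 * Z.of_nat (Z.to_nat (j - 1)) + 3)%Z with p by lia.
        split; [|now split].
        assert (j - 1 < up ((h / 8 - 3) / 2))%Z; [|unfold K; lia].
        apply lt_IZR. rewrite Hj, plus_IZR, mult_IZR in Hlt. rewrite minus_IZR. lra.
    - apply atmost_or; [apply atmost_multiples; [lra|lia]|]. apply atmost_or.
      + apply atmost_cover with (fun k n => I n /\ ((2 * Z.of_nat k + 3) ^ 2 | n)%Z); [auto|].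
        intros k _. apply atmost_multiples; [lra|]. nia.
      + apply atmost_transfer with (fun u => hit x h u /\ h / 8 <= IZR u)
          (fun n p => (p ^ 2 | n)%Z /\ h / 8 <= IZR p).
        * intros n [Hn [p [[m Hm] [Hodd Hp]]]]. exists p. repeat split; try assumption.
          -- exists m. rewrite pow_IZR, <- mult_IZR. change (Z.of_nat 2) with 2%Z.
             rewrite <- Hm. exact Hn.
          -- now exists m.
        * intros n n' p [Hn _] [Hn' _] [[m Hm] Hp] [[m' Hm'] _].
          assert (Hp2 : h < IZR (p ^ 2)).
          { replace (p ^ 2)%Z with (p * p)%Z by ring. rewrite mult_IZR. nra. }
          unfold I in *.
          assert (n - n' < p ^ 2)%Z by (apply lt_IZR; rewrite minus_IZR; lra).
          assert (n' - n < p ^ 2)%Z by (apply lt_IZR; rewrite minus_IZR; lra).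
          assert (0 < p ^ 2)%Z by (apply lt_IZR; lra).
          subst n n'. generalize dependent (p ^ 2)%Z. intros q **.
          assert (m = m') by nia. now subst.
        * assumption. }
  apply atmost_interval_lower in H.
  rewrite rsum_plus, rsum_const in H.
  assert (S1 : rsum (fun k => h / IZR ((2 * Z.of_nat k + 3) ^ 2)) K <= h * / 4).
  { apply Rle_trans with (h * rsum (fun k => / (2 * INR k + 3) ^ 2) K).
    - rewrite <- rsum_scal. apply rsum_le. intros k _. right. unfold Rdiv.
      change 2%Z with (Z.of_nat 2) at 2. rewrite <- pow_IZR, plus_IZR, mult_IZR, <- INR_IZR_INZ. reflexivity.
    - apply Rmult_le_compat_l; [lra|]. eapply Rle_trans; [apply rsum_odd_squares|].
      assert (0 < / (4 * (INR K + 1))); [|lra]. apply Rinv_0_lt_compat.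
      assert (H0 := pos_INR K). lra. }
  lra.
Qed.

(** * Explicit windows *)

(* [window_count] in units of [y = x^(1/5)], with [h = T y], [U = y w], [V = l U] and gaps cut at [2 A = (9/10) a w]. *)
Lemma scaled_window_count (y T w l a s B P : R) :
  0 < y -> 0 < T -> 0 < w -> 1 < l <= 2 -> 0 < a -> 0 < s -> 0 < B -> 0 <= P ->
  4 * T <= y * w ^ 2 -> T * l ^ 4 * w ^ 2 < 12 * y ^ 2 ->
  (T * l ^ 5 * w ^ 3 < 16 * y \/ 3 * T * l ^ 5 < w) ->
  72 / 5 * a * s ^ 3 / w ^ 4 + 2 * s * T / (y * w ^ 2) <= 1 ->
  (1 < B -> 12 * (l - 1) * y ^ 3 / (w * (y * w ^ 2 - 2 * T)) * B <= P) ->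
  atmost (window_hit (y ^ 5) (T * y) (y * w) (l * (y * w)))
    (10 / 9 * (l - 1) / a * y + 1 + 9 / 20 * a * w * (2 + 4 * T / w)
      + 9 / 40 * a * T * (l ^ 6 - l ^ 2) * w / s * y
      + 2 * (1 - / l ^ 4) * (9 / 20 * a) ^ 2 * (9 / 20 * a + / w) ^ 2 * y
      + P + 4 / 3 / B * ((2 * T / w + 1) * (T * l ^ 6 * w ^ 4 / (8 * s)))).
Proof.
  intros Hy HT Hw Hl Ha Hs HB HP C1 C2 C3 C4 C5.
  assert (Hyw : 0 < y * w) by (apply Rmult_lt_0_compat; lra).
  assert (Hy5 : 0 < y ^ 5) by (apply pow_lt; lra).
  assert (HTy : 0 < T * y) by (apply Rmult_lt_0_compat; lra).
  assert (Hden : 0 < y * w ^ 2 - 2 * T) by lra.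
  assert (Hadm : admissible (y ^ 5) (T * y) (y * w) (l * (y * w)) (9 / 20 * a * w) s).
  { repeat split; try assumption; try nra.
    - assert (0 < y ^ 6 * w ^ 2) by (apply Rmult_lt_0_compat; apply pow_lt; lra).
      assert (0 < y ^ 5 * w ^ 2) by (apply Rmult_lt_0_compat; apply pow_lt; lra).
      replace (T * y * (l * (y * w)) ^ 4) with (y ^ 5 * w ^ 2 * (T * l ^ 4 * w ^ 2)) by ring.
      replace (12 * y ^ 5 * (y * w) ^ 2) with (y ^ 5 * w ^ 2 * (12 * y ^ 2)) by ring.
      now apply Rmult_lt_compat_l.
    - destruct C3 as [C3|C3]; [left|right].
      + assert (0 < y ^ 6 * w ^ 2) by (apply Rmult_lt_0_compat; apply pow_lt; lra).
        replace (T * y * (l * (y * w)) ^ 5) with (y ^ 6 * w ^ 2 * (T * l ^ 5 * w ^ 3)) by ring.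
        replace (16 * y ^ 5 * (y * w) ^ 2) with (y ^ 6 * w ^ 2 * (16 * y)) by ring.
        now apply Rmult_lt_compat_l.
      + assert (0 < y ^ 6 * w ^ 5) by (apply Rmult_lt_0_compat; apply pow_lt; lra).
        replace (3 * (T * y) * (l * (y * w)) ^ 5) with (y ^ 6 * w ^ 5 * (3 * T * l ^ 5)) by ring.
        replace ((y * w) ^ 6) with (y ^ 6 * w ^ 5 * w) by ring.
        now apply Rmult_lt_compat_l.
    - eapply Rle_trans; [|exact C4]. right. field. repeat split; lra. }
  eapply atmost_le; [intros z Hz; exact Hz| |].
  2: apply (window_count _ _ _ _ _ _ B P Hadm); try assumption; [nra|].
  - right. field. repeat split; lra.
  - intros HB1. eapply Rle_trans; [|exact (C5 HB1)]. right. field.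
    repeat split; try lra; nra.
Qed.

(* Near [U = h/8] many hits may share a value of [D], so the gap cut-off [9 g w / 10] must shrink with [w]. The exponents in [w = T^3 g^7] and [s = (2/5) T^4 g^9] keep [g s^3 / w^4] constant and make both the long-gap and the cluster contributions proportional to [y / g]. *)
Lemma low_window_count (y T g l w : R) :
  2000 <= T -> 10000 * T ^ 9 <= y -> 0 < g <= 1 -> w = T ^ 3 * g ^ 7 -> T <= 10 * w ->
  l = (51 / 50) ^ 7 ->
  atmost (window_hit (y ^ 5) (T * y) (y * w) (l * (y * w))) (y * (4 / 5 * / g)).
Proof.
  intros HT Hy Hg Hw Hwl Hl.
  assert (Hl1 : 1.1486 < l < 1.1487) by (rewrite Hl; lra).
  assert (Hl2 : 1.319 < l ^ 2 < 1.3196) by nra.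
  assert (Hl4 : 1.739 < l ^ 4 < 1.7414) by (replace (l ^ 4) with (l ^ 2 * l ^ 2) by ring; nra).
  assert (Hl5 : l ^ 5 < 2.001) by (replace (l ^ 5) with (l * l ^ 4) by ring; nra).
  assert (Hl6 : l ^ 6 < 2.298) by (replace (l ^ 6) with (l ^ 2 * l ^ 4) by ring; nra).
  assert (HT3 : 2000 ^ 2 * T <= T ^ 3).
  { replace (T ^ 3) with (T ^ 2 * T) by ring. apply Rmult_le_compat_r; [lra|].
    apply pow_incr. lra. }
  assert (HT93 : 2000 ^ 6 * T ^ 3 <= T ^ 9).
  { replace (T ^ 9) with (T ^ 6 * T ^ 3) by ring. apply Rmult_le_compat_r; [lra|].
    apply pow_incr. lra. }
  assert (Hg1 : forall n, 0 < g ^ n <= 1).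
  { intros n. split; [apply pow_lt; lra|]. rewrite <- (pow1 n). apply pow_incr. lra. }
  assert (Hw3 : w <= T ^ 3).
  { rewrite Hw. destruct (Hg1 7%nat). nra. }
  assert (Hg2 := Hg1 2%nat).
  (* With the factor 2/5 the main part of the smallness condition is (72/5) (2/5)^3 = 576/625,
     leaving room for the rounding term. *)
  set (s := 2 / 5 * T * g ^ 2 * w).
  assert (Hs : 0 < s) by (unfold s; repeat (apply Rmult_lt_0_compat; try lra)).
  assert (Hw0 : 200 <= w) by lra.
  assert (Hiw : 0 < / w <= / 200) by (split; [apply Rinv_0_lt_compat|apply Rinv_le_contravar]; lra).
  assert (HTw : T / w <= 10) by (apply div_le_iff; lra).
  eapply atmost_le; [intros z Hz; exact Hz| |
    apply (scaled_window_count y T w l g s 1 0); try lra; try assumption].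
  - assert (E1 : 9 / 40 * g * T * (l ^ 6 - l ^ 2) * w / s * y
      = y * (9 / 16 * (l ^ 6 - l ^ 2) * / g)) by (unfold s; field; lra).
    assert (E2 : (2 * T / w + 1) * (T * l ^ 6 * w ^ 4 / (8 * s))
      = 5 / 16 * ((2 * (T / w) + 1) * (l ^ 6 * (T ^ 9 * g ^ 19)))).
    { rewrite Hw. unfold s. rewrite Hw. field. lra. }
    rewrite E1, E2. clear E1 E2.
    assert (Hig : 1 <= / g) by (rewrite <- Rinv_1; apply Rinv_le_contravar; lra).
    assert (Hil : / 1.7414 <= / l ^ 4) by (apply Rinv_le_contravar; lra).
    (* With [B = 1] the linear count is off, and the whole inverse cube tail remains. It is of order
       T^9, which 10000 T^9 <= y absorbs. *)
    assert (B0 : (2 * (T / w) + 1) * (l ^ 6 * (T ^ 9 * g ^ 19)) <= 21 * (2.298 * T ^ 9)).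
    { destruct (Hg1 19%nat). assert (0 < T / w) by (apply Rdiv_lt_0_compat; lra).
      assert (0 < l ^ 6) by (apply pow_lt; lra).
      apply Rmult_le_compat; [lra| |lra|].
      - repeat (apply Rmult_le_pos; try lra).
      - apply Rmult_le_compat; [lra| |lra|]; [apply Rmult_le_pos; lra|].
        rewrite <- (Rmult_1_r (T ^ 9)) at 2. apply Rmult_le_compat_l; lra. }
    assert (B1 : 9 / 20 * g * w * (2 + 4 * T / w) <= 20 * T ^ 3).
    { replace (9 / 20 * g * w * (2 + 4 * T / w)) with (9 / 20 * (g * (2 * w + 4 * T)))
        by (field; lra).
      assert (g * (2 * w + 4 * T) <= 1 * (2 * w + 4 * T)) by (apply Rmult_le_compat_r; lra). lra. }
    assert (B2 : 2 * (1 - / l ^ 4) * (9 / 20 * g) ^ 2 * (9 / 20 * g + / w) ^ 2 <= 0.038).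
    { assert (0 < (9 / 20 * g) ^ 2 <= 0.2025).
      { split; [apply pow_lt; lra|]. replace 0.2025 with (0.45 ^ 2) by lra. apply pow_incr. lra. }
      assert (Hz : 0 < 9 / 20 * g + / w <= 0.455) by lra.
      assert (0 < (9 / 20 * g + / w) ^ 2 <= 0.2071).
      { split; [apply pow_lt; lra|]. apply Rle_trans with (0.455 ^ 2); [|lra].
        apply pow_incr. lra. }
      assert (0 < / l ^ 4) by (apply Rinv_0_lt_compat; lra).
      assert (/ l ^ 4 < 1) by (rewrite <- Rinv_1; apply Rinv_lt_contravar; lra).
      apply Rle_trans with (2 * (1 - / 1.7414) * 0.2025 * 0.2071); [|lra].
      apply Rmult_le_compat; try lra.
      - repeat apply Rmult_le_pos; lra.
      - apply Rmult_le_compat; lra. }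
    assert (B3 : 10 / 9 * (l - 1) / g * y <= y * (0.16523 * / g)).
    { replace (10 / 9 * (l - 1) / g * y) with (y * (10 / 9 * (l - 1) * / g)) by (field; lra).
      apply Rmult_le_compat_l; [lra|]. apply Rmult_le_compat_r; lra. }
    assert (B4 : y * (9 / 16 * (l ^ 6 - l ^ 2) * / g) <= y * (0.551 * / g)).
    { apply Rmult_le_compat_l; [lra|]. apply Rmult_le_compat_r; lra. }
    assert (B6 : y <= y * / g).
    { rewrite <- (Rmult_1_r y) at 1. apply Rmult_le_compat_l; lra. }
    assert (B5 : 2 * (1 - / l ^ 4) * (9 / 20 * g) ^ 2 * (9 / 20 * g + / w) ^ 2 * y <= y * (0.038 * / g)).
    { apply Rle_trans with (0.038 * y); [apply Rmult_le_compat_r; lra|]. lra. }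
    lra.
  - assert (1 * 1 <= w ^ 2) by (simpl; apply Rmult_le_compat; lra).
    assert (y * 1 <= y * w ^ 2) by (apply Rmult_le_compat_l; lra). lra.
  - assert (T * l ^ 4 * w ^ 2 <= T * 1.7414 * (T ^ 3) ^ 2).
    { apply Rmult_le_compat; [apply Rmult_le_pos; lra|apply pow_le; lra| |].
      - apply Rmult_le_compat_l; lra.
      - apply pow_incr. lra. }
    assert (T * (T ^ 3) ^ 2 <= T ^ 9).
    { replace (T * (T ^ 3) ^ 2) with (T ^ 7 * 1) by ring.
      replace (T ^ 9) with (T ^ 7 * T ^ 2) by ring.
      apply Rmult_le_compat_l; [apply pow_le; lra|]. assert (1 * 1 <= T * T); [|lra].
      apply Rmult_le_compat; lra. }
    assert (1 * y <= y * y) by (apply Rmult_le_compat_r; lra). lra.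
  (* Near the lower end [w] may be as small as [T / 10], and the second alternative can fail; but
     then [w] is at most a small multiple of [T], and T w^3 is negligible against [y]. *)
  - destruct (Rlt_dec (3 * T * l ^ 5) w) as [H|H]; [now right|left].
    assert (w <= 6.003 * T).
    { apply Rle_trans with (3 * T * l ^ 5); [lra|].
      replace (6.003 * T) with (3 * T * 2.001) by lra. apply Rmult_le_compat_l; lra. }
    assert (w ^ 3 <= (6.003 * T) ^ 3) by (apply pow_incr; lra).
    assert (T * l ^ 5 * w ^ 3 <= T * 2.001 * (6.003 * T) ^ 3).
    { apply Rmult_le_compat; [| apply pow_le; lra| |assumption].
      - apply Rmult_le_pos; [lra|]. apply pow_le. lra.
      - apply Rmult_le_compat_l; lra. }
    assert (T * T ^ 3 <= T ^ 9).
    { replace (T ^ 9) with (T ^ 4 * T ^ 5) by ring. replace (T * T ^ 3) with (T ^ 4 * 1) by ring.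
      apply Rmult_le_compat_l; [apply pow_le; lra|]. rewrite <- (pow1 5). apply pow_incr. lra. }
    replace (T * 2.001 * (6.003 * T) ^ 3) with (2.001 * 6.003 ^ 3 * (T * T ^ 3)) in * by ring.
    lra.
  - replace (72 / 5 * g * s ^ 3 / w ^ 4) with (576 / 625 * (T ^ 3 * g ^ 7) / w)
      by (unfold s; field; lra).
    rewrite <- Hw. replace (576 / 625 * w / w) with (576 / 625) by (field; lra).
    replace (2 * s * T / (y * w ^ 2)) with (4 / 5 * (g ^ 2 * (T / w) * T) / y)
      by (unfold s; field; lra).
    assert (g ^ 2 * (T / w) * T <= 10 * T).
    { apply Rmult_le_compat_r; [lra|]. assert (0 < T / w) by (apply Rdiv_lt_0_compat; lra).
      replace 10 with (1 * 10) by ring. apply Rmult_le_compat; lra. }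
    assert (4 / 5 * (g ^ 2 * (T / w) * T) / y <= 0.01) by (apply div_le_iff; lra). lra.
Qed.

(* [B] balances the two ways of counting short gaps: both contributions are then proportional to [y / k], whose sum over the windows is a constant times [y]. *)
Lemma middle_window_count (y T k l w : R) :
  2000 <= T -> 10000 * T ^ 9 <= y -> 1 <= k -> w = T ^ 3 * k ^ 6 -> T * w <= y ->
  l = (41 / 40) ^ 6 ->
  atmost (window_hit (y ^ 5) (T * y) (y * w) (l * (y * w))) (y * (0.2148 + 3.42 * / k)).
Proof.
  intros HT Hy Hk Hw Hwy Hl.
  assert (Hl1 : 1.1596 < l < 1.1597) by (rewrite Hl; lra).
  assert (Hl2 : 1.3446 < l ^ 2 < 1.345) by (split; nra).
  assert (Hl4 : 1.807 < l ^ 4 < 1.8091) by (replace (l ^ 4) with (l ^ 2 * l ^ 2) by ring; split; nra).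
  assert (Hl5 : l ^ 5 < 2.1) by (replace (l ^ 5) with (l * l ^ 4) by ring; nra).
  assert (Hl6 : l ^ 6 < 2.434) by (replace (l ^ 6) with (l ^ 2 * l ^ 4) by ring; nra).
  assert (Hk1 : forall n, 1 <= k ^ n).
  { intros n. rewrite <- (pow1 n). apply pow_incr. lra. }
  assert (HT3 : 2000 ^ 2 * T <= T ^ 3).
  { replace (T ^ 3) with (T ^ 2 * T) by ring. apply Rmult_le_compat_r; [lra|].
    apply pow_incr. lra. }
  assert (HT92 : 2000 ^ 7 * T ^ 2 <= T ^ 9).
  { replace (T ^ 9) with (T ^ 7 * T ^ 2) by ring. apply Rmult_le_compat_r; [apply pow_le; lra|].
    apply pow_incr. lra. }
  assert (HT2 : 2000 * T <= T ^ 2).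
  { replace (T ^ 2) with (T * T) by ring. apply Rmult_le_compat_r; lra. }
  assert (Hw3 : T ^ 3 <= w).
  { rewrite Hw. rewrite <- (Rmult_1_r (T ^ 3)) at 1. apply Rmult_le_compat_l; [lra|apply Hk1]. }
  set (s := 2 / 5 * T * k ^ 2 * w).
  assert (Hk2 := Hk1 2%nat).
  assert (Hs : 0 < s) by (unfold s; repeat (apply Rmult_lt_0_compat; try lra)).
  assert (Hiw : 0 < / w <= / 1000000).
  { split; [apply Rinv_0_lt_compat|apply Rinv_le_contravar]; lra. }
  assert (HTw : 0 < T / w <= / 1000000).
  { split; [apply Rdiv_lt_0_compat; lra|]. apply div_le_iff; lra. }
  assert (Hik : 0 < / k <= 1).
  { split; [apply Rinv_0_lt_compat; lra|]. rewrite <- Rinv_1. apply Rinv_le_contravar; lra. }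
  assert (HTk : 0 < 3 / 4 * T ^ 9 * k ^ 17 / y).
  { apply Rdiv_lt_0_compat; [|lra]. assert (H := Hk1 17%nat).
    apply Rmult_lt_0_compat; [|lra]. assert (0 < T ^ 9) by (apply pow_lt; lra). lra. }
  assert (Hyw : y * 1 <= y * w) by (apply Rmult_le_compat_l; lra).
  assert (Hyw2 : y * w * 1 <= y * w * w) by (apply Rmult_le_compat_l; lra).
  eapply atmost_le; [intros z Hz; exact Hz| |
    apply (scaled_window_count y T w l 1 s (3 / 4 * T ^ 9 * k ^ 17 / y) (1.45 * y * / k));
      try lra; try assumption].
  - assert (E1 : 9 / 40 * 1 * T * (l ^ 6 - l ^ 2) * w / s * y
      = y * (9 / 16 * (l ^ 6 - l ^ 2) * / k ^ 2)) by (unfold s; field; lra).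
    assert (E2 : 4 / 3 / (3 / 4 * T ^ 9 * k ^ 17 / y)
        * ((2 * T / w + 1) * (T * l ^ 6 * w ^ 4 / (8 * s)))
      = 5 / 9 * (2 * (T / w) + 1) * l ^ 6 * (y * / k)).
    { rewrite Hw. unfold s. rewrite Hw. field. lra. }
    rewrite E1, E2. clear E1 E2.
    (* Budget per window: 0.2148 is 0.17745 from long gaps, 0.0368 from the cubes, and slack; 3.42
       exceeds 1.3523 (inverse cube tail) + 0.613 (clusters) + 1.45 (linear count). *)
    assert (B0 : 5 / 9 * (2 * (T / w) + 1) * l ^ 6 * (y * / k) <= 1.3523 * (y * / k)).
    { apply Rmult_le_compat_r; [apply Rmult_le_pos; lra|].
      apply Rle_trans with (0.55557 * 2.434); [|lra].
      apply Rmult_le_compat; [lra|apply pow_le; lra|lra|lra]. }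
    assert (B1 : 9 / 20 * 1 * w * (2 + 4 * T / w) = 9 / 10 * w + 9 / 5 * T) by (field; lra).
    assert (B1' : 2000 * w <= y).
    { apply Rle_trans with (T * w); [apply Rmult_le_compat_r; lra|assumption]. }
    assert (B2 : 2 * (1 - / l ^ 4) * (9 / 20 * 1) ^ 2 * (9 / 20 * 1 + / w) ^ 2 <= 0.0368).
    { assert (0 < (9 / 20 * 1 + / w) ^ 2 <= 0.20251).
      { split; [apply pow_lt; lra|]. apply Rle_trans with (0.450001 ^ 2); [|lra].
        apply pow_incr. lra. }
      assert (/ 1.8091 <= / l ^ 4) by (apply Rinv_le_contravar; lra).
      assert (/ l ^ 4 < 1) by (rewrite <- Rinv_1; apply Rinv_lt_contravar; lra).
      apply Rle_trans with (2 * (1 - / 1.8091) * (9 / 20 * 1) ^ 2 * 0.20251); [|lra].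
      apply Rmult_le_compat; lra. }
    assert (B3 : 10 / 9 * (l - 1) / 1 * y <= 0.17745 * y).
    { unfold Rdiv. rewrite Rinv_1. apply Rmult_le_compat_r; lra. }
    assert (B4 : y * (9 / 16 * (l ^ 6 - l ^ 2) * / k ^ 2) <= 0.613 * (y * / k)).
    { replace (0.613 * (y * / k)) with (y * (0.613 * / k)) by ring.
      apply Rmult_le_compat_l; [lra|].
      assert (0 < / k ^ 2) by (apply Rinv_0_lt_compat; lra).
      assert (/ k ^ 2 <= / k).
      { apply Rinv_le_contravar; [lra|]. replace (k ^ 2) with (k * k) by ring.
        rewrite <- (Rmult_1_r k) at 1. apply Rmult_le_compat_l; lra. }
      apply Rle_trans with (0.613 * / k ^ 2); [apply Rmult_le_compat_r; lra|].
      apply Rmult_le_compat_l; lra. }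
    assert (B5 : 2 * (1 - / l ^ 4) * (9 / 20 * 1) ^ 2 * (9 / 20 * 1 + / w) ^ 2 * y <= 0.0368 * y).
    { apply Rmult_le_compat_r; lra. }
    assert (0 <= y * / k) by (apply Rmult_le_pos; lra).
    lra.
  - assert (0 <= y * / k) by (apply Rmult_le_pos; lra). lra.
  - assert (HTw0 : 2000 * w <= T * w) by (apply Rmult_le_compat_r; lra).
    assert (T * w * w <= y * y) by (apply Rmult_le_compat; lra).
    assert (0 < T * w * w) by (apply Rmult_lt_0_compat; lra).
    replace (T * l ^ 4 * w ^ 2) with (l ^ 4 * (T * w * w)) by ring.
    assert (l ^ 4 * (T * w * w) <= 1.8091 * (T * w * w)) by (apply Rmult_le_compat_r; lra).
    replace (12 * y ^ 2) with (12 * (y * y)) by ring. lra.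
  - right. assert (3 * T * l ^ 5 <= 3 * T * 2.1) by (apply Rmult_le_compat_l; lra). lra.
  - replace (72 / 5 * 1 * s ^ 3 / w ^ 4) with (576 / 625 * (T ^ 3 * k ^ 6) / w)
      by (unfold s; field; lra).
    rewrite <- Hw. replace (576 / 625 * w / w) with (576 / 625) by (field; lra).
    replace (2 * s * T / (y * w ^ 2)) with (4 / 5 * (T ^ 2 * k ^ 2 / w) / y)
      by (unfold s; field; lra).
    assert (T ^ 2 * k ^ 2 / w <= T ^ 2).
    { apply div_le_iff; [lra|]. apply Rmult_le_compat_l; [lra|].
      rewrite Hw. replace (k ^ 6) with (k ^ 2 * k ^ 4) by ring.
      assert (H4 := Hk1 4%nat). assert (k ^ 2 * 1 <= k ^ 2 * k ^ 4) by (apply Rmult_le_compat_l; lra).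
      assert (1 * (k ^ 2 * k ^ 4) <= T ^ 3 * (k ^ 2 * k ^ 4)) by (apply Rmult_le_compat_r; lra).
      lra. }
    assert (4 / 5 * (T ^ 2 * k ^ 2 / w) / y <= 0.01) by (apply div_le_iff; lra). lra.
  - intros _.
    assert (Hden : 0.999 * (y * w ^ 2) <= y * w ^ 2 - 2 * T).
    { replace (y * w ^ 2) with (y * w * w) by ring. lra. }
    assert (0 < w ^ 2) by (apply pow_lt; lra).
    assert (Hyw3 : 0 < y * w ^ 2) by (apply Rmult_lt_0_compat; lra).
    assert (0 < y ^ 3) by (apply pow_lt; lra).
    apply Rle_trans with
      (12 * (l - 1) * y ^ 3 / (w * (0.999 * (y * w ^ 2))) * (3 / 4 * T ^ 9 * k ^ 17 / y)).
    + apply Rmult_le_compat_r; [lra|]. unfold Rdiv. apply Rmult_le_compat_l.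
      * apply Rmult_le_pos; lra.
      * apply Rinv_le_contravar; [apply Rmult_lt_0_compat; lra|]. apply Rmult_le_compat_l; lra.
    + replace (12 * (l - 1) * y ^ 3 / (w * (0.999 * (y * w ^ 2))) * (3 / 4 * T ^ 9 * k ^ 17 / y))
        with (9 / 0.999 * (l - 1) * (y * / k)).
      * replace (1.45 * y * / k) with (1.45 * (y * / k)) by ring.
        apply Rmult_le_compat_r; [apply Rmult_le_pos; lra|lra].
      * rewrite Hw. field. lra.
Qed.

(** The cut-off [G] grows like U^(4/3), which keeps the main term 4 x G^3 / U^4 equal to (108/125) T
    / r^3, and [r] stands for the cube root of [T]. The count decays like 1/k^2, so apart from the
    [+ 1] this range adds no factor ln x. *)
Lemma high_window_count (y T k l r : R) :
  2000 <= T -> 10000 * T ^ 9 <= y -> 1 <= k -> 0 < r -> T <= r ^ 3 ->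
  l = (41 / 40) ^ 6 -> y ^ 2 / T * k ^ 6 <= y ^ 3 ->
  atmost (window_hit (y ^ 5) (T * y) (y ^ 2 / T * k ^ 6) (l * (y ^ 2 / T * k ^ 6)))
    (0.1331 * r * y * (/ k ^ 2) + 1).
Proof.
  intros HT Hy Hk Hr Hr3 Hl HU3.
  assert (Hl1 : 1.1596 < l < 1.1597) by (rewrite Hl; lra).
  assert (Hl3 : l ^ 3 < 1.57) by (simpl; nra).
  assert (Hl4 : l ^ 4 < 1.82) by (replace (l ^ 4) with (l * l ^ 3) by ring; nra).
  assert (Hk1 : forall n, 1 <= k ^ n).
  { intros n. rewrite <- (pow1 n). apply pow_incr. lra. }
  assert (HT97 : 2000 ^ 2 * T ^ 7 <= T ^ 9).
  { replace (T ^ 9) with (T ^ 2 * T ^ 7) by ring. apply Rmult_le_compat_r; [apply pow_le; lra|].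
    apply pow_incr. lra. }
  assert (HT72 : 2000 ^ 5 * T ^ 2 <= T ^ 7).
  { replace (T ^ 7) with (T ^ 5 * T ^ 2) by ring. apply Rmult_le_compat_r; [apply pow_le; lra|].
    apply pow_incr. lra. }
  assert (HT2 : 2000 * T <= T ^ 2).
  { replace (T ^ 2) with (T * T) by ring. apply Rmult_le_compat_r; lra. }
  set (U := y ^ 2 / T * k ^ 6) in *.
  set (G := 3 / 5 * (y / (T * r)) * k ^ 8).
  assert (Hk2 := Hk1 2%nat). assert (Hk6 := Hk1 6%nat). assert (Hk8 := Hk1 8%nat).
  assert (Hy2 : y * y = y ^ 2) by ring.
  assert (HyT : 1 <= y / T) by (apply le_div_iff; lra).
  assert (HU0 : y ^ 2 / T <= U).
  { unfold U. rewrite <- (Rmult_1_r (y ^ 2 / T)) at 1. apply Rmult_le_compat_l; [|lra].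
    left. apply Rdiv_lt_0_compat; [apply pow_lt|]; lra. }
  assert (HUy : y <= U).
  { apply Rle_trans with (y ^ 2 / T); [|assumption]. apply le_div_iff; [lra|].
    rewrite <- Hy2. apply Rmult_le_compat_l; lra. }
  assert (HG : 0 < G).
  { unfold G. apply Rmult_lt_0_compat; [|lra]. apply Rmult_lt_0_compat; [lra|].
    apply Rdiv_lt_0_compat; [lra|]. apply Rmult_lt_0_compat; lra. }
  assert (HTy : 0 < T * y) by (apply Rmult_lt_0_compat; lra).
  assert (Hy5 : 0 < y ^ 5) by (apply pow_lt; lra).
  eapply atmost_le; [intros z Hz; exact Hz| |
    apply (sparse_window_count (y ^ 5) (T * y) U (l * U) G); try assumption].
  - apply Rplus_le_compat_r. replace ((l * U - U) / (2 * G)) with ((l - 1) / (6 / 5) * (r * y * / k ^ 2)).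
    + replace (0.1331 * r * y * / k ^ 2) with (0.1331 * (r * y * / k ^ 2)) by ring.
      apply Rmult_le_compat_r; [|lra].
      repeat apply Rmult_le_pos; try lra. left. apply Rinv_0_lt_compat. lra.
    + unfold G, U. field. lra.
  - split; [lra|]. rewrite <- (Rmult_1_l U) at 1. apply Rmult_lt_compat_r; lra.
  - apply Rmult_le_compat_r; lra.
  - assert (2 * T <= y) by lra.
    assert (2 * T * y <= y * y) by (apply Rmult_le_compat_r; lra).
    assert (y ^ 2 <= U ^ 2) by (apply pow_incr; lra). lra.
  - assert (0 < U ^ 2) by (apply pow_lt; lra).
    replace (T * y * (l * U) ^ 3) with (U ^ 2 * (l ^ 3 * (T * y * U))) by ring.
    replace (4 * y ^ 5 * U ^ 2) with (U ^ 2 * (4 * y ^ 5)) by ring.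
    apply Rmult_lt_compat_l; [assumption|].
    assert (T * y * U <= y * (y * y ^ 3)).
    { replace (T * y * U) with (T * (y * U)) by ring. apply Rmult_le_compat; [lra| |lra|].
      - apply Rmult_le_pos; lra.
      - apply Rmult_le_compat_l; lra. }
    replace (y * (y * y ^ 3)) with (y ^ 5) in * by ring.
    assert (0 < T * y * U) by (apply Rmult_lt_0_compat; lra).
    assert (l ^ 3 * (T * y * U) <= 1.57 * (T * y * U)) by (apply Rmult_le_compat_r; lra). lra.
  - assert (0 < U ^ 4) by (apply pow_lt; lra).
    replace (128 * (T * y) * (y ^ 5) ^ 2 * (l * U) ^ 4)
      with (U ^ 4 * (128 * l ^ 4 * (T * y ^ 11))) by ring.
    replace (U ^ 10) with (U ^ 4 * U ^ 6) by ring. apply Rmult_lt_compat_l; [assumption|].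
    apply Rlt_le_trans with ((y ^ 2 / T) ^ 6).
    + replace ((y ^ 2 / T) ^ 6) with (y * (y ^ 11) / T ^ 6) by (field; lra).
      apply lt_div_iff; [apply pow_lt; lra|].
      replace (128 * l ^ 4 * (T * y ^ 11) * T ^ 6) with (128 * l ^ 4 * T ^ 7 * y ^ 11) by ring.
      apply Rmult_lt_compat_r; [apply pow_lt; lra|].
      assert (0 < T ^ 7) by (apply pow_lt; lra).
      assert (128 * l ^ 4 * T ^ 7 <= 128 * 1.82 * T ^ 7) by (apply Rmult_le_compat_r; lra). lra.
    + apply pow_incr. split; [|assumption]. left. apply Rdiv_lt_0_compat; [apply pow_lt|]; lra.
  - replace (4 * y ^ 5 * G ^ 3 / U ^ 4) with (108 / 125 * (T / r ^ 3)).
    + assert (0 < r ^ 3) by (apply pow_lt; lra).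
      assert (T / r ^ 3 <= 1) by (apply div_le_iff; lra).
      assert (T * y / U <= 0.01).
      { apply div_le_iff; [lra|]. apply Rle_trans with (0.01 * (y ^ 2 / T)); [|lra].
        replace (0.01 * (y ^ 2 / T)) with (0.01 * y ^ 2 / T) by (unfold Rdiv; ring).
        apply le_div_iff; [lra|]. rewrite <- Hy2.
        replace (T * y * T) with (y * T ^ 2) by ring.
        replace (0.01 * (y * y)) with (y * (0.01 * y)) by ring.
        apply Rmult_le_compat_l; lra. }
      lra.
    + unfold G, U. field. lra.
Qed.

(** * Summation over windows *)

Lemma geometric_cover (U0 rho u : R) (n : nat) :
  U0 <= u < U0 * rho ^ n ->
  exists j, (j < n)%nat /\ U0 * rho ^ j <= u < rho * (U0 * rho ^ j).
Proof.
  induction n as [|n IH]; intros Hu; [simpl in Hu; lra|].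
  destruct (Rlt_dec u (U0 * rho ^ n)) as [H|H].
  - destruct IH as [j [Hj Hu']]; [lra|]. exists j. split; [lia|assumption].
  - exists n. split; [lia|]. simpl in Hu.
    replace (rho * (U0 * rho ^ n)) with (U0 * (rho * rho ^ n)) by ring. lra.
Qed.

Lemma power_reaches (rho M : R) : 1 < rho ->
  exists n, M <= rho ^ n /\ forall j, (j < n)%nat -> rho ^ j < M.
Proof.
  intros Hrho. destruct (nat_least (fun n => M <= rho ^ n)) as [n [Hn Hmin]].
  - destruct (Pow_x_infinity rho) with (b := M) as [N HN]; [rewrite Rabs_pos_eq; lra|].
    exists N. specialize (HN N (Nat.le_refl N)). rewrite Rabs_pos_eq in HN; [lra|].
    apply pow_le. lra.
  - exists n. split; [assumption|]. intros j Hj. apply Rnot_le_lt. intros H.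
    specialize (Hmin j H). lia.
Qed.

Lemma rsum_geometric (q : R) (n : nat) : 0 <= q < 1 ->
  rsum (fun j => q ^ j) n <= / (1 - q).
Proof.
  intros Hq. assert (H : rsum (fun j => q ^ j) n = (1 - q ^ n) * / (1 - q)).
  { induction n as [|n IH]; cbn [rsum]; [simpl; lra|]. rewrite IH. simpl. field. lra. }
  rewrite H. assert (0 <= q ^ n) by (apply pow_le; lra).
  assert (0 < / (1 - q)) by (apply Rinv_0_lt_compat; lra). nra.
Qed.

Lemma exp_INR_mult (z : R) (n : nat) : exp (INR n * z) = exp z ^ n.
Proof.
  induction n as [|n IH]; [simpl; rewrite Rmult_0_l; apply exp_0|].
  rewrite S_INR, Rmult_plus_distr_r, exp_plus, IH, Rmult_1_l. simpl. ring.
Qed.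

(** From exp(-1/41) >= 40/41 follows ln(41/40) >= 1/41, so each step of the progression advances the
    logarithm by at least 6/41. *)
Lemma power_count (z : R) (n : nat) : 0 <= z ->
  (forall j, (j < n)%nat -> ((41 / 40) ^ 6) ^ j < exp z) -> INR n <= 1 + 41 / 6 * z.
Proof.
  intros Hz H. destruct n as [|n]; [simpl; lra|].
  specialize (H n (Nat.lt_succ_diag_r n)). rewrite S_INR.
  assert (He : exp (/ 41) <= 41 / 40).
  { assert (H1 := exp_ineq1_le (- / 41)). rewrite exp_Ropp in H1.
    assert (Hp := exp_pos (/ 41)). apply Rmult_le_reg_r with (/ exp (/ 41)).
    - now apply Rinv_0_lt_compat.
    - rewrite Rinv_r by lra. lra. }
  assert (Hpow : exp (6 / 41 * INR n) <= ((41 / 40) ^ 6) ^ n).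
  { rewrite <- pow_mult. replace (6 / 41 * INR n) with (INR (6 * n) * / 41).
    - rewrite exp_INR_mult. apply pow_incr. split; [left; apply exp_pos|assumption].
    - rewrite mult_INR. simpl. field. }
  assert (6 / 41 * INR n < z) by (apply exp_lt_inv; lra). lra.
Qed.

(** The windows are anchored at their upper end [y T^3], so [g] is (51/50)^(j - n) and the sum of
    1/g is governed by the lowest window, where 1/g is below (51/50) r2. The constant is (4/5)
    (51/50) 51, rounded up. *)
Lemma low_range_count (y T r2 : R) (n : nat) :
  2000 <= T -> 10000 * T ^ 9 <= y -> 0 < r2 -> 8 * T ^ 2 <= r2 ^ 7 ->
  (forall j, (j < n)%nat -> ((51 / 50) ^ 7) ^ j < 8 * T ^ 2) ->
  atmost (fun u => exists j, (j < n)%nat /\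
      window_hit (y ^ 5) (T * y) (y * T ^ 3 / ((51 / 50) ^ 7) ^ n * ((51 / 50) ^ 7) ^ j)
        ((51 / 50) ^ 7 * (y * T ^ 3 / ((51 / 50) ^ 7) ^ n * ((51 / 50) ^ 7) ^ j)) u)
    (y * (41.63 * r2)).
Proof.
  intros HT HyT Hr2 HTr2 Hn.
  assert (HT0 : 0 < T ^ 3) by (apply pow_lt; lra).
  assert (Hy0 : 0 < y) by (assert (0 < T ^ 9) by (apply pow_lt; lra); lra).
  assert (Hmu : forall i, 1 <= (51 / 50) ^ i) by (intros; apply pow_R1_Rle; lra).
  assert (Hq : forall i, (50 / 51) ^ i = / (51 / 50) ^ i).
  { intros i. rewrite <- pow_inv. f_equal. field. }
  assert (H7 : forall i, ((51 / 50) ^ 7) ^ i = ((51 / 50) ^ i) ^ 7).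
  { intros i. rewrite <- !pow_mult. f_equal. lia. }
  apply atmost_le with (fun u => exists j, (j < n)%nat /\
      window_hit (y ^ 5) (T * y) (y * T ^ 3 / ((51 / 50) ^ 7) ^ n * ((51 / 50) ^ 7) ^ j)
        ((51 / 50) ^ 7 * (y * T ^ 3 / ((51 / 50) ^ 7) ^ n * ((51 / 50) ^ 7) ^ j)) u)
    (rsum (fun j => 4 / 5 * y * (51 / 50) ^ n * (50 / 51) ^ j) n); [auto| |].
  - rewrite rsum_scal. destruct n as [|m]; [simpl; nra|].
    assert (Hm : (51 / 50) ^ m < r2).
    { apply Rnot_le_lt. intros H. assert (H1 := Hn m (Nat.lt_succ_diag_r m)). rewrite H7 in H1.
      assert (r2 ^ 7 <= ((51 / 50) ^ m) ^ 7) by (apply pow_incr; lra). lra. }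
    assert (Hs := rsum_geometric (50 / 51) (S m) ltac:(lra)).
    apply Rle_trans with (4 / 5 * y * (51 / 50) ^ S m * / (1 - 50 / 51)).
    + apply Rmult_le_compat_l; [|assumption]. assert (H1 := Hmu (S m)). nra.
    + replace (4 / 5 * y * (51 / 50) ^ S m * / (1 - 50 / 51))
        with (y * (4 / 5 * (51 / 50) * 51 * (51 / 50) ^ m)) by (simpl; field).
      apply Rmult_le_compat_l; lra.
  - apply atmost_cover with (fun j => window_hit (y ^ 5) (T * y)
      (y * T ^ 3 / ((51 / 50) ^ 7) ^ n * ((51 / 50) ^ 7) ^ j)
      ((51 / 50) ^ 7 * (y * T ^ 3 / ((51 / 50) ^ 7) ^ n * ((51 / 50) ^ 7) ^ j))); [auto|].
    intros j Hj. set (g := (51 / 50) ^ j / (51 / 50) ^ n).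
    assert (Hjn : (51 / 50) ^ j <= (51 / 50) ^ n) by (apply Rle_pow; [lra|lia]).
    assert (H1 := Hmu j). assert (H2 := Hmu n).
    assert (Hg : 0 < g <= 1).
    { unfold g. split; [apply Rdiv_lt_0_compat; lra|]. apply div_le_iff; lra. }
    replace (y * T ^ 3 / ((51 / 50) ^ 7) ^ n * ((51 / 50) ^ 7) ^ j) with (y * (T ^ 3 * g ^ 7)).
    2: { unfold g. rewrite !H7. field. lra. }
    eapply atmost_le; [intros z Hz; exact Hz| |
      apply (low_window_count y T g _ (T ^ 3 * g ^ 7)); try assumption; try reflexivity].
    + right. unfold g. rewrite Hq. field. lra.
    (* The lowest window may overshoot [T y / 8] by one step of the progression: 9.2 = 1.15 * 8. *)
    + assert (Hw : / (9.2 * T ^ 2) <= g ^ 7).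
      { destruct n as [|m]; [lia|]. assert (Hm := Hn m (Nat.lt_succ_diag_r m)). rewrite H7 in Hm.
        apply Rle_trans with ((/ (51 / 50) ^ S m) ^ 7).
        - rewrite pow_inv. apply Rinv_le_contravar; [apply pow_lt; lra|].
          replace (((51 / 50) ^ S m) ^ 7) with ((51 / 50) ^ 7 * ((51 / 50) ^ m) ^ 7) by (simpl; ring).
          assert (Hc : (51 / 50) ^ 7 <= 1.15) by lra.
          apply Rle_trans with (1.15 * (8 * T ^ 2)); [|lra].
          apply Rmult_le_compat; [apply pow_le| |assumption|left; assumption]; [lra|].
          apply pow_le. assert (H3 := Hmu m). lra.
        - apply pow_incr. split; [left; apply Rinv_0_lt_compat; lra|].
          unfold g, Rdiv. rewrite <- (Rmult_1_l (/ _)) at 1. apply Rmult_le_compat_r; [|lra].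
          left. apply Rinv_0_lt_compat. lra. }
      assert (Hw' : T ^ 3 * / (9.2 * T ^ 2) <= T ^ 3 * g ^ 7) by (apply Rmult_le_compat_l; lra).
      replace (T ^ 3 * / (9.2 * T ^ 2)) with (T / 9.2) in Hw' by (field; lra). lra.
Qed.

(** The source of the logarithm: 0.2148 is paid once per window, whereas the terms in 1/k form a
    geometric series with sum at most 41. The constant is 41 * 3.42 + 0.2148, rounded up. *)
Lemma middle_range_count (L y T : R) (n : nat) :
  2000 <= T -> 10000 * T ^ 9 <= y -> 0 <= L -> y = exp (L / 5) ->
  (forall j, (j < n)%nat -> ((41 / 40) ^ 6) ^ j < y / T ^ 4) ->
  atmost (fun u => exists j, (j < n)%nat /\
      window_hit (y ^ 5) (T * y) (y * T ^ 3 * ((41 / 40) ^ 6) ^ j)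
        ((41 / 40) ^ 6 * (y * T ^ 3 * ((41 / 40) ^ 6) ^ j)) u)
    (y * (0.2148 * (41 / 30 * L) + 140.44)).
Proof.
  intros HT HyT HL Hy Hn.
  assert (HT3 : 0 < T ^ 3) by (apply pow_lt; lra).
  assert (HT4 : 1 <= T ^ 4) by (apply pow_R1_Rle; lra).
  assert (Hy0 : 0 < y) by (rewrite Hy; apply exp_pos).
  assert (Hxi : forall i, 1 <= (41 / 40) ^ i) by (intros; apply pow_R1_Rle; lra).
  assert (Hq : forall i, (40 / 41) ^ i = / (41 / 40) ^ i).
  { intros i. rewrite <- pow_inv. f_equal. field. }
  assert (H6 : forall i, ((41 / 40) ^ 6) ^ i = ((41 / 40) ^ i) ^ 6).
  { intros i. rewrite <- !pow_mult. f_equal. lia. }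
  assert (Hcount : INR n <= 1 + 41 / 6 * (L / 5)).
  { apply power_count; [lra|]. intros j Hj. rewrite <- Hy.
    eapply Rlt_le_trans; [apply (Hn j Hj)|]. apply div_le_iff; [lra|].
    rewrite <- (Rmult_1_r y) at 1. apply Rmult_le_compat_l; lra. }
  eapply atmost_le; [intros z Hz; exact Hz| |].
  2: apply atmost_cover with (n := n) (r := fun j => y * 0.2148 + y * 3.42 * (40 / 41) ^ j)
    (Q := fun j => window_hit (y ^ 5) (T * y) (y * T ^ 3 * ((41 / 40) ^ 6) ^ j)
        ((41 / 40) ^ 6 * (y * T ^ 3 * ((41 / 40) ^ 6) ^ j))); [auto|].
  - rewrite rsum_plus, rsum_const, rsum_scal.
    assert (Hs := rsum_geometric (40 / 41) n ltac:(lra)).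
    match goal with |- context [rsum ?f n] =>
      set (S1 := rsum f n) in *; change (S1 <= / (1 - 40 / 41)) in Hs end.
    assert (y * 3.42 * S1 <= y * 3.42 * 41) by (apply Rmult_le_compat_l; lra).
    assert (INR n * (y * 0.2148) <= (1 + 41 / 6 * (L / 5)) * (y * 0.2148))
      by (apply Rmult_le_compat_r; lra).
    lra.
  - intros j Hj. set (k := (41 / 40) ^ j). assert (Hk : 1 <= k) by apply Hxi.
    replace (y * T ^ 3 * ((41 / 40) ^ 6) ^ j) with (y * (T ^ 3 * k ^ 6)) by (rewrite H6; unfold k; ring).
    eapply atmost_le; [intros z Hz; exact Hz| |
      apply (middle_window_count y T k _ (T ^ 3 * k ^ 6)); try assumption; try reflexivity].
    + rewrite Hq. fold k. right. ring.
    + specialize (Hn j Hj). rewrite H6 in Hn. fold k in Hn. rewrite lt_div_iff in Hn by lra.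
      replace (T * (T ^ 3 * k ^ 6)) with (k ^ 6 * T ^ 4) by ring. lra.
Qed.

Lemma high_range_count (L y T r : R) (n : nat) :
  400 <= L -> 2000 <= T -> 10000 * T ^ 9 <= y -> y = exp (L / 5) -> 0 < r -> T <= r ^ 3 ->
  (forall j, (j < n)%nat -> ((41 / 40) ^ 6) ^ j < y * T) ->
  atmost (fun u => exists j, (j < n)%nat /\
      window_hit (y ^ 5) (T * y) (y ^ 2 / T * ((41 / 40) ^ 6) ^ j)
        ((41 / 40) ^ 6 * (y ^ 2 / T * ((41 / 40) ^ 6) ^ j)) u /\
      y ^ 2 / T * ((41 / 40) ^ 6) ^ j <= y ^ 3)
    (y * (2.77 * r + 0.01)).
Proof.
  intros HL HT HyT Hy Hr HTr Hn.
  assert (HT8 : 2000 ^ 8 * T <= T ^ 9).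
  { replace (T ^ 9) with (T ^ 8 * T) by ring. apply Rmult_le_compat_r; [lra|].
    apply pow_incr. lra. }
  assert (Hxi : forall i, 1 <= (41 / 40) ^ i) by (intros; apply pow_R1_Rle; lra).
  assert (Hq : forall i, ((40 / 41) ^ 2) ^ i = / ((41 / 40) ^ i) ^ 2).
  { intros i. rewrite <- !pow_mult, (Nat.mul_comm i 2), <- pow_inv. f_equal. field. }
  assert (H6 : forall i, ((41 / 40) ^ 6) ^ i = ((41 / 40) ^ i) ^ 6).
  { intros i. rewrite <- !pow_mult. f_equal. lia. }
  (* Absorbs the [+ 1] of each window; it comes from exp(L/5) >= (L/20)^4. *)
  assert (HyL : 400 * L <= y).
  { replace (L / 5) with (INR 4 * (L / 20)) in Hy by (simpl; field).
    rewrite exp_INR_mult in Hy. assert (H1 := exp_ineq1_le (L / 20)).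
    assert ((L / 20) ^ 4 <= y) by (rewrite Hy; apply pow_incr; lra).
    assert (400 ^ 3 * L <= L ^ 3 * L).
    { apply Rmult_le_compat_r; [lra|]. apply pow_incr. lra. }
    replace ((L / 20) ^ 4) with (L ^ 3 * L / 160000) in * by field. lra. }
  assert (Hcount : INR n <= 1 + 41 / 6 * (2 * (L / 5))).
  { apply power_count; [lra|]. intros j Hj.
    replace (2 * (L / 5)) with (L / 5 + L / 5) by ring. rewrite exp_plus, <- Hy.
    eapply Rlt_le_trans; [apply (Hn j Hj)|]. apply Rmult_le_compat_l; lra. }
  eapply atmost_le; [intros z Hz; exact Hz| |].
  2: apply atmost_cover with (n := n) (r := fun j => 0.1331 * r * y * ((40 / 41) ^ 2) ^ j + 1)
    (Q := fun j u => window_hit (y ^ 5) (T * y) (y ^ 2 / T * ((41 / 40) ^ 6) ^ j)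
        ((41 / 40) ^ 6 * (y ^ 2 / T * ((41 / 40) ^ 6) ^ j)) u /\
      y ^ 2 / T * ((41 / 40) ^ 6) ^ j <= y ^ 3); [auto|].
  - rewrite rsum_plus, rsum_const, rsum_scal.
    assert (Hs := rsum_geometric ((40 / 41) ^ 2) n ltac:(split; lra)).
    assert (0 < r * y) by (apply Rmult_lt_0_compat; lra).
    match goal with |- context [rsum ?f n] =>
      set (S1 := rsum f n) in *; change (S1 <= / (1 - (40 / 41) ^ 2)) in Hs end.
    assert (r * y * S1 <= r * y * / (1 - (40 / 41) ^ 2)) by (apply Rmult_le_compat_l; lra).
    lra.
  - intros j Hj. set (k := (41 / 40) ^ j). assert (Hk : 1 <= k) by apply Hxi.
    rewrite H6, Hq. fold k.
    destruct (Rle_lt_dec (y ^ 2 / T * k ^ 6) (y ^ 3)) as [Hle|Hlt].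
    + eapply atmost_le; [intros z [Hz _]; exact Hz| |
        apply (high_window_count y T k _ r); try assumption; try reflexivity].
      right. ring.
    + apply atmost_le with (fun _ => False) 0; [intros z [_ Hz]; lra| |now apply atmost_false].
      assert (0 < / k ^ 2) by (apply Rinv_0_lt_compat, pow_lt; lra).
      assert (0 <= 0.1331 * r * y * / k ^ 2); [|lra].
      assert (0 < r * y * / k ^ 2); [|lra]. repeat apply Rmult_lt_0_compat; lra.
Qed.

Lemma hits_count (L y T r r2 : R) :
  400 <= L -> y = exp (L / 5) -> 2000 <= T <= 5 * L -> 10000 * T ^ 9 <= y ->
  0 < r -> 0 < r2 -> T <= r ^ 3 -> 8 * T ^ 2 <= r2 ^ 7 ->
  atmost (fun u => hit (y ^ 5) (T * y) u /\ T * y / 8 <= IZR u)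
    (y * (41.63 * r2 + 0.2148 * (41 / 30 * L) + 2.77 * r + 140.45)).
Proof.
  intros HL Hy HT HyT Hr Hr2 HTr HTr2.
  assert (HTp : forall n, 0 < T ^ n) by (intros; apply pow_lt; lra).
  assert (HT92 : 2000 ^ 7 * T ^ 2 <= T ^ 9).
  { replace (T ^ 9) with (T ^ 7 * T ^ 2) by ring. apply Rmult_le_compat_r; [left; apply HTp|].
    apply pow_incr. lra. }
  assert (HT2 : 2000 * T <= T ^ 2).
  { replace (T ^ 2) with (T * T) by ring. apply Rmult_le_compat_r; lra. }
  assert (Hy0 : 10 ^ 20 <= y) by lra.
  destruct (power_reaches ((51 / 50) ^ 7) (8 * T ^ 2)) as [n1 [N1 M1]]; [lra|].
  destruct (power_reaches ((41 / 40) ^ 6) (y / T ^ 4)) as [n2 [N2 M2]]; [lra|].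
  destruct (power_reaches ((41 / 40) ^ 6) (y * T)) as [n3 [N3 M3]]; [lra|].
  set (l1 := (51 / 50) ^ 7) in *. set (l2 := (41 / 40) ^ 6) in *.
  assert (Hl1 : 1.1486 < l1 < 1.1487) by (unfold l1; lra).
  assert (Hl2 : 1.1596 < l2 < 1.1597) by (unfold l2; lra).
  assert (Hl1p : forall n, 0 < l1 ^ n) by (intros; apply pow_lt; lra).
  set (win := fun U l => window_hit (y ^ 5) (T * y) U (l * U)).
  set (U1 := y * T ^ 3 / l1 ^ n1).
  set (P1 := fun u => exists j, (j < n1)%nat /\ win (U1 * l1 ^ j) l1 u).
  set (P2 := fun u => exists j, (j < n2)%nat /\ win (y * T ^ 3 * l2 ^ j) l2 u).
  set (P3 := fun u => exists j, (j < n3)%nat /\ win (y ^ 2 / T * l2 ^ j) l2 u /\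
                        y ^ 2 / T * l2 ^ j <= y ^ 3).
  assert (A1 : atmost P1 (y * (41.63 * r2))) by (apply (low_range_count y T r2 n1); assumption || lra).
  assert (A2 : atmost P2 (y * (0.2148 * (41 / 30 * L) + 140.44)))
    by (apply (middle_range_count L y T n2); assumption || lra).
  assert (A3 : atmost P3 (y * (2.77 * r + 0.01)))
    by (apply (high_range_count L y T r n3); assumption || lra).
  eapply atmost_le; [| |exact (atmost_or _ _ _ _ A1 (atmost_or _ _ _ _ A2 A3))]; [|lra].
  intros u [Hu Hlow].
  assert (Hu0 : 0 < IZR u) by nra.
  (* The multiplier of a hit is at least 1, so u^2 <= x + h < y^6. *)
  assert (Hu3 : IZR u < y ^ 3).
  { destruct Hu as [_ [m Hm]].
    assert (Hy5 : 0 < y ^ 5) by (apply pow_lt; lra).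
    assert (1 <= m)%Z as Hm1.
    { assert (0 < m)%Z; [|lia]. apply lt_IZR. assert (0 < IZR u ^ 2) by (apply pow_lt; lra).
      apply Rmult_lt_reg_r with (IZR u ^ 2); lra. }
    apply IZR_le in Hm1. apply Rnot_le_lt. intros Hge.
    assert ((y ^ 3) ^ 2 <= IZR u ^ 2) by (apply pow_incr; split; [apply pow_le|]; lra).
    assert (1 * IZR u ^ 2 <= IZR m * IZR u ^ 2).
    { apply Rmult_le_compat_r; [apply pow_le|]; lra. }
    assert (E6 : (y ^ 3) ^ 2 = y * y ^ 5) by ring.
    assert (10 ^ 20 * y ^ 5 <= y * y ^ 5) by (apply Rmult_le_compat_r; lra).
    assert (T * y <= y * y) by (apply Rmult_le_compat_r; lra).
    assert (y * y * 1 <= y ^ 5).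
    { replace (y ^ 5) with (y * y * (y ^ 3)) by ring. apply Rmult_le_compat_l; [nra|].
      rewrite <- (pow1 3). apply pow_incr. lra. }
    lra. }
  destruct (Rlt_dec (IZR u) (y * T ^ 3)) as [H1|H1]; [left|right].
  - destruct (geometric_cover U1 l1 (IZR u) n1) as [j [Hj Hw]].
    + unfold U1. split.
      * apply Rle_trans with (T * y / 8); [|assumption]. apply div_le_iff; [apply Hl1p|].
        replace (y * T ^ 3) with (T * y / 8 * (8 * T ^ 2)) by field.
        apply Rmult_le_compat_l; [nra|assumption].
      * replace (y * T ^ 3 / l1 ^ n1 * l1 ^ n1) with (y * T ^ 3)
          by (field; apply Rgt_not_eq, Hl1p). assumption.
    + exists j. split; [assumption|]. now split.
  - destruct (Rlt_dec (IZR u) (y ^ 2 / T)) as [H2|H2]; [left|right].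
    + destruct (geometric_cover (y * T ^ 3) l2 (IZR u) n2) as [j [Hj Hw]].
      * split; [lra|]. eapply Rlt_le_trans; [exact H2|].
        replace (y ^ 2 / T) with (y * T ^ 3 * (y / T ^ 4)) by (field; lra).
        apply Rmult_le_compat_l; [|assumption]. apply Rmult_le_pos; [lra|left; apply HTp].
      * exists j. split; [assumption|]. now split.
    + destruct (geometric_cover (y ^ 2 / T) l2 (IZR u) n3) as [j [Hj Hw]].
      * split; [lra|]. eapply Rlt_le_trans; [exact Hu3|].
        replace (y ^ 3) with (y ^ 2 / T * (y * T)) by (field; lra).
        apply Rmult_le_compat_l; [|assumption].
        left. apply Rdiv_lt_0_compat; [apply pow_lt|]; lra.
      * exists j. split; [assumption|]. split; [now split|lra].
Qed.

(** * Numerical budget and thresholds *)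

Lemma exp_dominates_ninth_power (L T : R) :
  400 <= L -> 0 <= T <= 5 * L -> 10000 * T ^ 9 <= exp (L / 5).
Proof.
  intros HL HT.
  (* At the extreme case L = 400, T = 2000 the claim follows from 7^40 > 10000 * 2000^9, a narrow
     margin; for larger L, exp(L/5 - 80) outgrows (L/400)^9. *)
  assert (E2 : 7 <= exp 2).
  { replace 2 with (INR 40 * (1 / 20)) by (rewrite INR_IZR_INZ; simpl; lra).
    rewrite exp_INR_mult. apply Rle_trans with ((21 / 20) ^ 40); [lra|].
    apply pow_incr. assert (H := exp_ineq1_le (1 / 20)). lra. }
  assert (E80 : 10000 * 2000 ^ 9 <= exp 80).
  { replace 80 with (INR 40 * 2) by (rewrite INR_IZR_INZ; simpl; lra).
    rewrite exp_INR_mult. apply Rle_trans with (7 ^ 40); [|apply pow_incr; lra].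
    rewrite !pow_IZR, <- mult_IZR. apply IZR_le. apply Z.leb_le. vm_compute. reflexivity. }
  assert (E : (L / 400) ^ 9 <= exp (L / 5 - 80)).
  { replace (L / 5 - 80) with (INR 9 * ((L / 5 - 80) / 9)) by (simpl; field).
    rewrite exp_INR_mult. apply pow_incr. split; [lra|].
    assert (H := exp_ineq1_le ((L / 5 - 80) / 9)). lra. }
  replace (L / 5) with (80 + (L / 5 - 80)) by ring. rewrite exp_plus.
  apply Rle_trans with (10000 * 2000 ^ 9 * (L / 400) ^ 9).
  - rewrite Rmult_assoc, <- Rpow_mult_distr. apply Rmult_le_compat_l; [lra|].
    apply pow_incr. lra.
  - apply Rmult_le_compat; [lra|apply pow_le; lra|assumption|assumption].
Qed.

Lemma squarefree_in_short_interval (x L T r r2 : R) :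
  0 < x -> L = ln x -> 400 <= L -> 2000 <= T <= 5 * L ->
  0 < r -> 0 < r2 -> T <= r ^ 3 -> 8 * T ^ 2 <= r2 ^ 7 ->
  41.63 * r2 + 0.2148 * (41 / 30 * L) + 2.77 * r + 140.46 <= 7 / 16 * T ->
  exists n : Z, squarefree n /\ x < IZR n <= x + T * exp (L / 5).
Proof.
  intros Hx HL HL4 HT Hr Hr2 HTr HTr2 Hbudget.
  set (y := exp (L / 5)).
  assert (HyT : 10000 * T ^ 9 <= y) by (apply exp_dominates_ninth_power; lra).
  assert (Hx5 : x = y ^ 5).
  { unfold y. rewrite <- exp_INR_mult. replace (INR 5 * (L / 5)) with L by (simpl; field).
    rewrite HL. symmetry. now apply exp_ln. }
  assert (HT9 : 2000 ^ 9 <= T ^ 9) by (apply pow_incr; lra).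
  apply NNPP. intros Hno.
  assert (H := squarefree_free_interval (y ^ 5) (T * y)
    (y * (41.63 * r2 + 0.2148 * (41 / 30 * L) + 2.77 * r + 140.45))).
  assert (2000 * y <= T * y) by (apply Rmult_le_compat_r; lra).
  assert (7 / 16 * (T * y) - 2
    <= y * (41.63 * r2 + 0.2148 * (41 / 30 * L) + 2.77 * r + 140.45)).
  { apply H; [lra|lra| |].
    - intros n Hn Hsq. apply Hno. exists n. split; [assumption|]. rewrite Hx5. exact Hn.
    - now apply hits_count. }
  (* Raising 140.45 to 140.46 gains [0.01 * y], which outweighs the 2 lost in counting integers. *)
  assert (y * (41.63 * r2 + 0.2148 * (41 / 30 * L) + 2.77 * r + 140.46) <= y * (7 / 16 * T))
    by (apply Rmult_le_compat_l; lra).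
  lra.
Qed.

Lemma ln_lower (x a : R) : exp a <= x -> 0 < x /\ a <= ln x.
Proof.
  intros H. assert (Hp := exp_pos a). split; [lra|].
  apply Rnot_lt_le. intros Hlt. apply exp_increasing in Hlt. rewrite exp_ln in Hlt; lra.
Qed.

Lemma cube_dominates (T c : R) : 0 < c -> c ^ 3 <= T ^ 2 -> 0 <= T -> T <= (T / c) ^ 3.
Proof.
  intros Hc H HT. replace ((T / c) ^ 3) with (T * T ^ 2 / c ^ 3) by (field; lra).
  apply le_div_iff; [apply pow_lt; lra|]. now apply Rmult_le_compat_l.
Qed.

Lemma seventh_power_dominates (T c : R) : 0 < c -> 8 * c ^ 7 <= T ^ 5 -> 0 <= T ->
  8 * T ^ 2 <= (T / c) ^ 7.
Proof.
  intros Hc H HT. replace ((T / c) ^ 7) with (T ^ 2 * T ^ 5 / c ^ 7) by (field; lra).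
  apply le_div_iff; [apply pow_lt; lra|].
  replace (8 * T ^ 2 * c ^ 7) with (T ^ 2 * (8 * c ^ 7)) by ring.
  apply Rmult_le_compat_l; [apply pow_le; lra|assumption].
Qed.

Theorem theorem1p3 :
  (forall x : R, exp 400 <= x ->
     exists n : Z, squarefree n /\
       x < IZR n <= x + 5 * Rpower x (1 / 5) * ln x)
  /\
  (forall x : R, exp 1800 <= x ->
     exists n : Z, squarefree n /\
       x < IZR n <= x + 2 * Rpower x (1 / 5) * ln x)
  /\
  (forall x : R, exp 500000 <= x ->
     exists n : Z, squarefree n /\
       x < IZR n <= x + Rpower x (1 / 5) * ln x).
Proof.
  assert (HR : forall x, Rpower x (1 / 5) = exp (ln x / 5)).
  { intros x. unfold Rpower. f_equal. field. }
  split; [|split]; intros x Hx; apply ln_lower in Hx; destruct Hx as [Hx0 HL]; rewrite HR.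
  - replace (5 * exp (ln x / 5) * ln x) with (5 * ln x * exp (ln x / 5)) by ring.
    assert (H5 : 2000 ^ 5 <= (5 * ln x) ^ 5) by (apply pow_incr; lra).
    assert (H2 : 2000 ^ 2 <= (5 * ln x) ^ 2) by (apply pow_incr; lra).
    (* Linear multiples of T replace T^(1/3) and (8 T^2)^(1/7), so the budget is linear in ln x.
       They dominate the roots from T = 2000 on, because 150^3 <= 2000^2 and 8 * 168^7 <= 2000^5.
       The divisors in the other two cases are chosen likewise. *)
    apply squarefree_in_short_interval with (r := 5 * ln x / 150) (r2 := 5 * ln x / 168);
      try lra; [apply cube_dominates|apply seventh_power_dominates]; lra.
  - replace (2 * exp (ln x / 5) * ln x) with (2 * ln x * exp (ln x / 5)) by ring.
    assert (H5 : 3600 ^ 5 <= (2 * ln x) ^ 5) by (apply pow_incr; lra).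
    assert (H2 : 3600 ^ 2 <= (2 * ln x) ^ 2) by (apply pow_incr; lra).
    apply squarefree_in_short_interval with (r := 2 * ln x / 200) (r2 := 2 * ln x / 250);
      try lra; [apply cube_dominates|apply seventh_power_dominates]; lra.
  - replace (exp (ln x / 5) * ln x) with (ln x * exp (ln x / 5)) by ring.
    assert (H5 : 500000 ^ 5 <= ln x ^ 5) by (apply pow_incr; lra).
    assert (H2 : 500000 ^ 2 <= ln x ^ 2) by (apply pow_incr; lra).
    apply squarefree_in_short_interval with (r := ln x / 1000) (r2 := ln x / 4000);
      try lra; [apply cube_dominates|apply seventh_power_dominates]; lra.
Qed.
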